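(* There exists a constant $C>0$, independent of $\lambda,\mu,\delta$ and $h^*$, such that for all $\delta>0$, all $\lambda,\mu>0$ with $\rho=\lambda/\mu<1$, and all $h^*\in\mathrm{Lip}(1)$, $$\big|\mathbb{E}h^*(X)-\mathbb{E}h^*(Y)\big|\le C\delta\Big(1+\frac1\rho\Big),$$ where $X$ has the stationary distribution of the scaled $M/M/1$ customer-count chain on $\delta\mathbb{N}$ and $Y$ has the stationary distribution of the approximating reflected Brownian motion, both described in the context.
   Context: $\mathbb{N}=\{0,1,2,\dots\}$. $\mathrm{Lip}(1)=\{h^*:\mathbb{R}\to\mathbb{R}: |h^*(x)-h^*(y)|\le|x-y| \text{ for all } x,y\in\mathbb{R}\}$. The chain is the continuous-time Markov chain on $\delta\mathbb{N}$ with generator $G_Xf(\delta k)=\lambda\big(f(\delta(k+1))-f(\delta k)\big)+\mu1(k>0)\big(f(\delta(k-1))-f(\delta k)\big)$, $k\in\mathbb{N}$: the number of customers, scaled by $\delta$, in a single-server queue with Poisson arrivals of rate $\lambda$ and exponential service times with rate $\mu$. Its stationary distribution (law of $X$) is geometric: $\mathbb{P}(X=\delta k)=(1-\rho)\rho^k$, $k\in\mathbb{N}$. The reflected Brownian motion is $Y(t)=Y(0)+\delta(\lambda-\mu)t+\delta\sqrt{\lambda+\mu}\,W(t)+R(t)$, where $W$ is standard Brownian motion and $R$ is the unique continuous non-decreasing process with $R(0)=0$, $Y(t)\ge0$, and $R$ increasing only at times when $Y(t)=0$. Its stationary distribution (law of $Y$) is exponential with mean $\frac{\delta(\lambda+\mu)}{2(\mu-\lambda)}$.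 *)

(* Defs.v *)
From HB Require Import structures.
From mathcomp Require Import all_boot all_order all_algebra.
From mathcomp Require Import all_classical all_reals all_analysis.

Set Implicit Arguments.
Unset Strict Implicit.
Unset Printing Implicit Defensive.

Import Order.TTheory GRing.Theory Num.Theory.
Import numFieldNormedType.Exports.

Local Open Scope classical_set_scope.
Local Open Scope ring_scope.

Definition Lip1 (R : realType) : set (R -> R) :=
  [set h | forall x y : R, `|h x - h y| <= `|x - y|].

(** The scaled customer-count chain of the M/M/1 queue.  The state
    [delta * k%:R] is represented by its index [k : nat]. *)

Definition mm1_generator (R : realType) (delta lambda mu : R) (f : R -> R)
    (k : nat) : R :=
  lambda * (f (delta * k.+1%:R) - f (delta * k%:R))
  + (if (0 < k)%N then mu * (f (delta * k.-1%:R) - f (delta * k%:R)) else 0).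

(** [p t i j] is the probability of going from state [i] to state [j] in time
    [t]; only the values of [p] at times [0 <= t] are meaningful. *)
Record markov_semigroup (R : realType) (p : R -> nat -> nat -> R) : Prop :=
  MarkovSemigroup {
    semigroup_ge0 : forall t i j, 0 <= t -> 0 <= p t i j ;
    semigroup_sum1 : forall t i, 0 <= t ->
      (\sum_(0 <= j <oo) (p t i j)%:E = 1)%E ;
    semigroup0 : forall i j, p 0 i j = (i == j)%:R ;
    semigroupD : forall s t i j, 0 <= s -> 0 <= t ->
      ((p (s + t) i j)%:E = \sum_(0 <= k <oo) (p s i k * p t k j)%:E)%E
  }.

(** (P_t f - f) / t tends pointwise to G_X f as t decreases to 0, for every f
    that is bounded on the state space. *)
Definition has_mm1_generator (R : realType) (delta lambda mu : R)
    (p : R -> nat -> nat -> R) : Prop :=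
  forall f : R -> R,
    (exists M : R, forall k : nat, `|f (delta * k%:R)| <= M) ->
    forall i : nat,
      t^-1 * (limn (series (fun j => p t i j * f (delta * j%:R)))
              - f (delta * i%:R))
        @[t --> 0^'+] --> mm1_generator delta lambda mu f i.

Definition mm1_stationary (R : realType) (delta lambda mu : R)
    (nu : probability R R) : Prop :=
  nu (range (fun k : nat => delta * k%:R)) = 1%E /\
  exists p : R -> nat -> nat -> R,
    [/\ markov_semigroup p, has_mm1_generator delta lambda mu p &
        forall (t : R) (j : nat), 0 <= t ->
          (\sum_(0 <= i <oo) (nu [set delta * i%:R]%R * (p t i j)%:E)
           = nu [set delta * j%:R]%R)%E].

(** Real-valued processes are families of random variables indexed by [R], of
    which only the members with index [0 <= t] are meaningful. *)

Definition mutually_independent d (T : measurableType d) (R : realType)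
    (P : probability T R) (n : nat) (X : 'I_n -> T -> R) : Prop :=
  forall A : 'I_n -> set R, (forall i, measurable (A i)) ->
    (P (\bigcap_(i in [set: 'I_n]) X i @^-1` A i)
     = \prod_(i < n) P (X i @^-1` A i))%E.

Record brownian_motion d (T : measurableType d) (R : realType)
    (P : probability T R) (W : R -> {RV P >-> R}) : Prop := BrownianMotion {
  brownian0 : forall w, W 0 w = 0 ;
  brownian_indep : forall (n : nat) (t : nat -> R),
    0 <= t 0%N -> (forall i, t i <= t i.+1) ->
    mutually_independent P
      (fun (i : 'I_n) w => W (t i.+1) w - W (t i) w) ;
  brownian_normal : forall (s t : R) (A : set R),
    0 <= s -> s < t -> measurable A ->
    P [set w | A (W t w - W s w)] = normal_prob 0 (Num.sqrt (t - s)) A ;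
  brownian_continuous : forall w,
    {within `[0, +oo[%classic, continuous (fun t => W t w)}
}.

Definition sigma_process d (T : measurableType d) (R : realType)
    (P : probability T R) (W : R -> {RV P >-> R}) : set (set T) :=
  <<s \bigcup_(t in [set t : R | 0 <= t])
        preimage_set_system setT (W t) measurable >>.

(** Independence of the initial value from the driving Brownian motion is part
    of the definition.  [rbm_flat] says that every time at which Y is positive
    has a neighbourhood on which L is constant, i.e. that L increases only at
    times when Y = 0. *)
Record reflected_brownian_motion d (T : measurableType d) (R : realType)
    (P : probability T R) (delta lambda mu : R)
    (W Y L : R -> {RV P >-> R}) : Prop := ReflectedBrownianMotion {
  rbm_driver : brownian_motion W ;
  rbm_indep : forall (A : set R) (B : set T),
    measurable A -> sigma_process W B ->
    (P ((Y 0%R @^-1` A) `&` B) = P (Y 0%R @^-1` A) * P B)%E ;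
  rbm_eq : forall t w, 0 <= t ->
    Y t w = Y 0 w + delta * (lambda - mu) * t
            + delta * Num.sqrt (lambda + mu) * W t w + L t w ;
  rbm_ge0 : forall t w, 0 <= t -> 0 <= Y t w ;
  rbm_regulator0 : forall w, L 0 w = 0 ;
  rbm_regulator_continuous : forall w,
    {within `[0, +oo[%classic, continuous (fun t => L t w)} ;
  rbm_regulator_nondecreasing : forall s t w,
    0 <= s -> s <= t -> L s w <= L t w ;
  rbm_flat : forall t w, 0 <= t -> 0 < Y t w ->
    \forall s \near t, 0 <= s -> L s w = L t w
}.

Definition rbm_stationary (R : realType) (delta lambda mu : R)
    (nu : probability R R) : Prop :=
  exists (d : measure_display) (T : measurableType d) (P : probability T R)
         (W Y L : R -> {RV P >-> R}),
    reflected_brownian_motion delta lambda mu W Y L /\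
    forall (t : R) (A : set R), 0 <= t -> measurable A ->
      distribution P (Y t) A = nu A.

(* Main.v *)
From HB Require Import structures.
Require Import Defs.
From mathcomp Require Import all_boot all_order all_algebra.
From mathcomp Require Import all_classical all_reals all_analysis.
From mathcomp Require Import measurable_realfun ring lra zify.

(** Both stationary laws are explicit, and an exponential variable rounded down
    to a lattice is geometric.  Write rho = lambda / mu.  X / delta is geometric
    with ratio rho and Y is exponential with mean
    m = delta (lambda + mu) / (2 (mu - lambda)).  With c = - m ln rho, the
    variable delta * floor (Y / c) has the law of X
    ([rounded_exponential_geometric]), and it differs from Y by at most
    delta + |delta / c - 1| Y.  Taking expectations, |E h(X) - E h(Y)| is at
    most delta + |delta / (- ln rho) - m|.  Now 1 / (- ln rho) lies between
    rho / (1 - rho) and 1 / (1 - rho), whose midpoint is exactly m / delta, so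
    the second term is at most delta / 2 ([log_mean_bound]).

    What takes work is to find the two laws from the dynamics.

    For the queue, stationarity is tested on the indicators of {0, ..., k}.
    Differentiating at time 0 gives the cut equation
    mu pi(k+1) = lambda pi(k) ([mm1_balance]).  The derivative may be taken
    under the infinite sum over initial states because
    1 - p_t(i,i) <= (lambda + mu) t uniformly in i ([holding_bound]), which
    follows from p_t(i,i) >= p_(t/n)(i,i)^n and Bernoulli's inequality.

    For the reflected process no stochastic calculus is needed: one short time
    step of length h is enough.  Let b = delta (lambda - mu),
    sigma = delta sqrt (lambda + mu) and Z = Y(0) + b h + sigma W(h), the step
    without reflection.  As W(h) is independent of Y(0), a Taylor expansion
    gives E f(Z) - E f(Y(0)) = h G + O(h^(3/2)) with
    G = E (b f' + sigma^2 f'' / 2) at Y(0), while stationarity says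
    E f(Y(h)) = E f(Y(0)).
    - The regulator only pushes up, so Y(h) >= Z, and G <= 0 for every
      nondecreasing f ([stationary_generator_le0]).
    - If f vanishes near 0, then f(Y(h)) = f(Z) unless W moves by a fixed amount
      before time h.  Dyadic chaining bounds that probability by O(h^2)
      ([brownian_maximal]), hence G = 0 ([stationary_generator_eq0]).

    The test functions are cubic splines, whose Taylor remainder is elementary.
    Up to a translate that disappears at infinity, f' is a smooth step S(. - x)
    of width 2 eta and f'' = S'(. - x) is a tent.  Hence
    m E S'(Y - x) <= E S(Y - x) for every x, with equality for x > 0.  The
    derivative of E S(Y - x) in x is - E S'(Y - x), so E S(Y - x) decays like
    exp (- x / m) on x >= 0 ([Estep_exp]).  The inequality just below the origin
    shows that Y puts mass O(eta) on [0, eta] ([pr_ball_small]), so there is no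
    atom at 0, and eta -> 0 gives P(Y > x) = exp (- x / m)
    ([exponential_tail]). *)


Set Implicit Arguments.
Unset Strict Implicit.
Unset Printing Implicit Defensive.

Import Order.TTheory GRing.Theory Num.Theory.
Import numFieldNormedType.Exports.

Local Open Scope classical_set_scope.
Local Open Scope ring_scope.

(** * Elementary estimates, derivatives and integrals *)

Section real_lemmas.
Context {R : realType}.
Implicit Types a b c : R.

(** The form in which errors proportional to a step size are discarded. *)
Lemma ler_addgt0_mul a b c : (forall e, 0 < e -> e < 1 -> a <= b + e * c) -> a <= b.
Proof.
move=> H; apply/ler_addgt0Pr => e e0.
pose d := Num.min (2^-1 : R) (e / (`|c| + 1)).
have c0 : 0 < `|c| + 1 by rewrite ltr_wpDl.
have d0 : 0 < d by rewrite lt_min invr_gt0 ltr0n/= divr_gt0.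
have d1 : d < 1 by rewrite gt_min; apply/orP; left; lra.
apply: (le_trans (H d d0 d1)); rewrite lerD2l.
apply: (@le_trans _ _ (d * (`|c| + 1))).
  rewrite ler_pM2l// (le_trans (ler_norm _))// lerDl//.
by rewrite -ler_pdivlMr// ge_min lexx orbT.
Qed.

Lemma expR_le1D2x (u : R) : 0 <= u -> u <= 2^-1 -> expR u <= 1 + 2 * u.
Proof.
move=> u0 u1; have := expR_ge1Dx (- u); rewrite expRN => h.
have e0 := expR_gt0 u.
have : (1 - u) * expR u <= 1 by rewrite -ler_pdivlMr// div1r.
nra.
Qed.

Lemma bernoulli_le (x : R) n : 0 <= x -> x <= 1 -> 1 - n%:R * (1 - x) <= x ^+ n.
Proof.
move=> x0 x1; elim: n => [|n ih]; first by rewrite mul0r subr0 expr0.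
rewrite exprS; apply: (@le_trans _ _ (x * (1 - n%:R * (1 - x)))); last by rewrite ler_wpM2l.
have n0 : 0 <= n%:R :> R by [].
have := mulr_ge0 n0 (sqr_ge0 (1 - x)); rewrite -natr1; move: (n%:R) => N; nra.
Qed.

(** Derivatives of splines and of their expectations are obtained from a
    remainder estimate: it survives integration without any interchange
    theorem. *)
Lemma is_derive_quadratic (f : R -> R) (x d C : R) :
  (forall u, `|u| <= 1 -> `|f (x + u) - f x - d * u| <= C * u ^+ 2) ->
  is_derive x 1 f d.
Proof.
move=> H.
have cv : u^-1 *: (f (u *: 1 + x) - f x) @[u --> 0^'] --> d.
  apply/cvgrPdist_le => e e0.
  pose r := Num.min 1 (e / (`|C| + 1)).
  have C0 : 0 < `|C| + 1 by rewrite ltr_wpDl.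
  have r0 : 0 < r by rewrite lt_min ltr01 divr_gt0.
  near=> u.
  have u0 : u != 0 by near: u; exact: nbhs_dnbhs_neq.
  have : `|u| < r by near: u; exact: dnbhs0_lt.
  rewrite lt_min => /andP[u1 ur].
  have -> : d - u^-1 *: (f (u *: 1 + x) - f x) = - u^-1 * (f (x + u) - f x - d * u).
    have -> : u *: (1 : R) + x = x + u by rewrite /GRing.scale/= mulr1 addrC.
    by rewrite /GRing.scale/=; field.
  rewrite normrM normrN normfV ler_pdivrMl ?normr_gt0//.
  apply: (le_trans (H u (ltW u1))).
  apply: (@le_trans _ _ ((`|C| + 1) * `|u| ^+ 2)).
    rewrite -[u ^+ 2]ger0_norm ?sqr_ge0// normrX ler_wpM2r ?sqr_ge0//.
    by rewrite (le_trans (ler_norm _))// lerDl.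
  rewrite expr2 mulrCA ler_wpM2l// mulrC -ler_pdivlMr//; exact: ltW.
have dv : derivable f x 1 by apply/cvg_ex; exists d.
by apply: DeriveDef => //; apply: cvg_lim.
Unshelve. all: by end_near.
Qed.

Lemma nondecreasing_of_quadratic (f f' : R -> R) (C : R) :
  (forall a u : R, `|u| <= 1 ->
    `|f (a + u) - f a - f' a * u| <= C * u ^+ 2) ->
  (forall a, 0 <= f' a) -> forall a b, a <= b -> f a <= f b.
Proof.
move=> H f'0 x y; rewrite le_eqVlt => /predU1P[->//|xy].
have dv (z : R) : is_derive z (1 : R) f (f' z) by exact: is_derive_quadratic (H z).
have cf : {within `[x, y], continuous f}.
  apply: continuous_subspaceT => z.
  by have [/derivable1_diffP/differentiable_continuous] := dv z.
have [c _ E] := MVT xy (fun z _ => dv z) cf.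
by rewrite -subr_ge0 E mulr_ge0// subr_ge0 ltW.
Qed.

End real_lemmas.

Section integral_toolkit.
Context d (T : measurableType d) (R : realType) (P : probability T R).
Implicit Types (f g : T -> R) (M c : R).

Lemma bounded_integrable f M : measurable_fun setT f ->
  (forall x, `|f x| <= M) -> P.-integrable setT (EFin \o f).
Proof.
move=> mf fM; apply: (@le_integrable _ _ _ P setT measurableT _ (EFin \o cst M)).
- exact/measurable_EFinP.
- by move=> x _ /=; rewrite lee_fin (le_trans (fM x))// ler_norm.
- exact: finite_measure_integrable_cst.
Qed.

Lemma dominated_integrable f g : measurable_fun setT f ->
  P.-integrable setT (EFin \o g) -> (forall x, `|f x| <= g x) ->
  P.-integrable setT (EFin \o f).
Proof.
move=> mf ig fg; apply: (@le_integrable _ _ _ P setT measurableT _ (EFin \o g)) => //.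
- exact/measurable_EFinP.
- by move=> x _ /=; rewrite lee_fin (le_trans (fg x))// ler_norm.
Qed.

Lemma integrable_EFin_cst (c : R) : P.-integrable setT (EFin \o (fun=> c)).
Proof. exact: finite_measure_integrable_cst. Qed.

Lemma integrable_EFinD f g : P.-integrable setT (EFin \o f) ->
  P.-integrable setT (EFin \o g) ->
  P.-integrable setT (EFin \o (fun x => f x + g x)).
Proof.
move=> fi gi; rewrite (_ : EFin \o _ = (EFin \o f) \+ (EFin \o g)); last by [].
exact: integrableD.
Qed.

Lemma integrable_EFinZ c f : P.-integrable setT (EFin \o f) ->
  P.-integrable setT (EFin \o (fun x => c * f x)).
Proof.
move=> fi; rewrite (_ : EFin \o _ = (fun x => c%:E * (EFin \o f) x)%E); last by [].
exact: integrableZl.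
Qed.

Lemma Rintegral_probability_cst (c : R) : \int[P]_w c = c.
Proof. by rewrite Rintegral_cst//= probability_setT/= mulr1. Qed.

End integral_toolkit.

(** * Moments of the normal distribution *)

Section normal_moments.
Context {R : realType}.
Local Notation mu := (@lebesgue_measure R).

Lemma ge0_integral_normal_prob (m s : R) (f : R -> \bar R) :
  measurable_fun setT f -> (forall x, 0 <= f x)%E ->
  (\int[normal_prob m s]_x f x = \int[mu]_x (f x * (normal_pdf m s x)%:E))%E.
Proof.
move=> mf f0.
have dom : normal_prob m s `<< mu by exact: normal_prob_dominates.
rewrite -(Radon_Nikodym_SigmaFinite.change_of_variables dom f0 measurableT mf).
have mpdf : measurable_fun setT (fun x => (normal_pdf m s x)%:E).
  by apply/measurable_EFinP; exact: measurable_normal_pdf.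
have iRN := Radon_Nikodym_SigmaFinite.f_integrable dom.
apply: ae_eq_integral => //=.
- by apply: emeasurable_funM => //; exact: (measurable_int _ iRN).
- exact: emeasurable_funM.
- apply: ae_eqe_mul2l; apply: integral_ae_eq => //=.
  move=> E _ mE; rewrite -(Radon_Nikodym_SigmaFinite.f_integral dom)//.
Qed.

(** The integrand times one centred normal density is a multiple of another
    one, of standard deviation [r * s], so the integral follows from the total
    mass of the latter. *)
Lemma normal_exp_sqr (s r : R) : 0 < s -> 0 < r ->
  (\int[normal_prob 0 s]_x (expR ((1 - r ^- 2) / (2 * s ^+ 2) * x ^+ 2))%:E
   = r%:E)%E.
Proof.
move=> s0 r0.
rewrite ge0_integral_normal_prob//; last first.
  apply/measurable_EFinP; apply: measurableT_comp => //.
  by apply: measurable_funM => //; exact: measurable_funX.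
transitivity (\int[mu]_x (r%:E * (normal_pdf 0 (r * s) x)%:E))%E; last first.
  by rewrite integralZl ?integral_normal_pdf ?mule1//; exact: integrable_normal_pdf.
apply: eq_integral => x _; rewrite -!EFinM; congr EFin.
have rs0 : r * s != 0 by rewrite gt_eqF// mulr_gt0.
rewrite !normal_pdfE ?gt_eqF ?mulr_gt0// /normal_peak /normal_fun.
have pk (u : R) : 0 < u -> Num.sqrt (u ^+ 2 * pi *+ 2) = u * Num.sqrt (pi *+ 2).
  by move=> u0; rewrite -mulrnAr sqrtrM ?sqr_ge0// sqrtr_sqr gtr0_norm.
rewrite !pk ?mulr_gt0// mulrCA.
have p0 : Num.sqrt (pi *+ 2 : R) != 0.
  by rewrite gt_eqF// sqrtr_gt0 pmulrn_lgt0// pi_gt0.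
rewrite -expRD subr0.
have -> : (1 - r ^- 2) / (2 * s ^+ 2) * x ^+ 2 + - x ^+ 2 / (s ^+ 2 *+ 2) =
   - x ^+ 2 / ((r * s) ^+ 2 *+ 2).
  by field; rewrite !gt_eqF.
by field; rewrite p0 !gt_eqF.
Qed.

(** The exponential factor shifts the mean of the density by [t * s ^+ 2]. *)
Lemma normal_exp (s t : R) : 0 < s ->
  (\int[normal_prob 0 s]_x (expR (t * x))%:E = (expR (t ^+ 2 * s ^+ 2 / 2))%:E)%E.
Proof.
move=> s0.
rewrite ge0_integral_normal_prob//; last first.
  by apply/measurable_EFinP; apply: measurableT_comp => //; exact: measurable_funM.
transitivity (\int[mu]_x ((expR (t ^+ 2 * s ^+ 2 / 2))%:E *
    (normal_pdf (t * s ^+ 2) s x)%:E))%E; last first.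
  by rewrite integralZl ?integral_normal_pdf ?mule1//; exact: integrable_normal_pdf.
apply: eq_integral => x _; rewrite -!EFinM; congr EFin.
rewrite !normal_pdfE ?gt_eqF// /normal_fun mulrCA [RHS]mulrCA -!expRD.
congr (_ * expR _); field; rewrite gt_eqF//.
Qed.

Lemma normal_moment4 (s : R) : 0 < s ->
  (\int[normal_prob 0 s]_x (x ^+ 4)%:E <= (60 * s ^+ 4)%:E)%E.
Proof.
move=> s0.
(* Doubling the standard deviation makes the exponent 3 x^2 / (8 s^2), which
   dominates x^4 up to a factor s^4. *)
have h := @normal_exp_sqr s 2 s0 (ltr0Sn _ 1).
have q34 : 1 - 2 ^- 2 = 3 / 4 :> R by field.
rewrite q34 in h.
apply: (@le_trans _ _ (\int[normal_prob 0 s]_x ((30 * s ^+ 4)%:E *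
    (expR (3 / 4 / (2 * s ^+ 2) * x ^+ 2))%:E))%E); last first.
  rewrite ge0_integralZl//; last first.
  - by rewrite lee_fin mulr_ge0// exprn_ge0// ltW.
  - apply/measurable_EFinP; apply: measurableT_comp => //.
    by apply: measurable_funM => //; exact: measurable_funX.
  by rewrite h -EFinM lee_fin; lra.
apply: ge0_le_integral => //.
- by move=> x _; rewrite lee_fin exprn_even_ge0.
- by apply/measurable_EFinP; exact: measurable_funX.
- apply/measurable_EFinP; apply: measurable_funM => //.
  apply: measurableT_comp => //.
  by apply: measurable_funM => //; exact: measurable_funX.
move=> x _; rewrite -EFinM lee_fin.
set u := (_ * x ^+ 2).
have uE : x ^+ 2 = (8 / 3) * s ^+ 2 * u.
  by rewrite /u; field; rewrite gt_eqF.
have u0 : 0 <= u by rewrite /u mulr_ge0 ?sqr_ge0// divr_ge0// mulr_ge0// sqr_ge0.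
have he := expR_ge1Dx (u / 2).
have -> : expR u = expR (u / 2) ^+ 2 by rewrite expr2 -expRD -splitr.
rewrite (_ : x ^+ 4 = (x ^+ 2) ^+ 2); last by rewrite -exprM.
rewrite uE.
have hs : 0 <= s ^+ 4 by rewrite exprn_even_ge0.
have : u ^+ 2 / 4 <= expR (u / 2) ^+ 2 by nra.
have -> : (8 / 3 * s ^+ 2 * u) ^+ 2 = s ^+ 4 * (64 / 9 * u ^+ 2) by field.
have -> : 30 * s ^+ 4 * expR (u / 2) ^+ 2 = s ^+ 4 * (30 * expR (u / 2) ^+ 2) by ring.
move=> h1; apply: ler_wpM2l => //; nra.
Qed.

Lemma normal_integrableX (s : R) (k : nat) : 0 < s -> (k <= 4)%N ->
  (normal_prob 0 s).-integrable setT (EFin \o (fun x : R => `|x| ^+ k)).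
Proof.
move=> s0 k4.
have i4 : (normal_prob 0 s).-integrable setT (EFin \o (fun x : R => 1 + x ^+ 4)).
  apply: integrable_EFinD; first exact: integrable_EFin_cst.
  apply/integrableP; split; first by apply/measurable_EFinP; exact: measurable_funX.
  apply: le_lt_trans (ltry (60 * s ^+ 4)).
  under eq_integral do rewrite gee0_abs ?lee_fin ?exprn_even_ge0//.
  exact: normal_moment4.
apply: (dominated_integrable _ i4).
  apply: measurable_funX; exact: normr_measurable.
move=> x; rewrite ger0_norm ?exprn_ge0//.
rewrite (_ : x ^+ 4 = `|x| ^+ 4); last by rewrite -normrX ger0_norm ?exprn_even_ge0.
have [x1|x1] := leP `|x| 1.
  rewrite (@le_trans _ _ 1)//; first by rewrite exprn_ile1.
  by rewrite lerDl exprn_ge0.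
rewrite (@le_trans _ _ (`|x| ^+ 4))//; first by rewrite ler_weXn2l// ltW.
by rewrite lerDr.
Qed.

Lemma normal_integrable_id (s : R) : 0 < s ->
  (normal_prob 0 s).-integrable setT (EFin \o (fun x : R => x)).
Proof.
move=> s0; apply: (dominated_integrable _ (@normal_integrableX s 1 s0 isT)) => //.
Qed.

Lemma normal_integrable_sqr (s : R) : 0 < s ->
  (normal_prob 0 s).-integrable setT (EFin \o (fun x : R => x ^+ 2)).
Proof.
move=> s0; apply: (dominated_integrable _ (@normal_integrableX s 2 s0 isT)).
  exact: measurable_funX.
by move=> x; rewrite normrX.
Qed.

(** From [1 + x <= expR x] under the integral of [normal_exp_sqr]: the exponent
    has the sign of [r - 1], so r decreasing to 1 bounds the second moment from
    above and r increasing to 1 bounds it from below. *)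
Lemma normal_moment2 (s : R) : 0 < s -> \int[normal_prob 0 s]_x (x ^+ 2) = s ^+ 2.
Proof.
move=> s0; set v := (X in X = _).
have i2 := normal_integrable_sqr s0.
have key r : 0 < r -> 1 + (1 - r ^- 2) / (2 * s ^+ 2) * v <= r.
  move=> r0; set th := (X in 1 + X * _).
  have mE : measurable_fun setT (fun x : R => expR (th * x ^+ 2)).
    apply: measurableT_comp => //.
    by apply: measurable_funM => //; exact: measurable_funX.
  have iE : (normal_prob 0 s).-integrable setT (EFin \o (fun x : R => expR (th * x ^+ 2))).
    apply/integrableP; split; first exact/measurable_EFinP.
    under eq_integral do rewrite gee0_abs ?lee_fin ?expR_ge0//.
    by rewrite normal_exp_sqr// ltry.
  have iL : (normal_prob 0 s).-integrable setT (EFin \o (fun x : R => th * x ^+ 2)).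
    exact: integrable_EFinZ.
  have -> : 1 + th * v = \int[normal_prob 0 s]_x (1 + th * x ^+ 2).
    rewrite RintegralD//; last exact: integrable_EFin_cst.
    by rewrite Rintegral_probability_cst RintegralZl.
  have -> : r = \int[normal_prob 0 s]_x (expR (th * x ^+ 2)).
    by rewrite /Rintegral normal_exp_sqr.
  apply: le_Rintegral => //; last by move=> x _; exact: expR_ge1Dx.
  by apply: integrable_EFinD => //; exact: integrable_EFin_cst.
have s2 : 0 < s ^+ 2 by rewrite exprn_gt0.
have v0 : 0 <= v by apply: Rintegral_ge0 => x _; exact: sqr_ge0.
have key' r : 0 < r -> v * ((r - 1) * (r + 1)) <= 2 * s ^+ 2 * r ^+ 2 * (r - 1).
  move=> r0; have := key r r0.
  have r2 : 0 < 2 * s ^+ 2 * r ^+ 2 by rewrite !mulr_gt0.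
  rewrite -lerBrDl -(ler_pM2l r2).
  have -> // : 2 * s ^+ 2 * r ^+ 2 * ((1 - r ^- 2) / (2 * s ^+ 2) * v) = v * ((r - 1) * (r + 1)).
  by field; rewrite !gt_eqF.
apply/eqP; rewrite eq_le; apply/andP; split.
  apply: (@ler_addgt0_mul R _ _ (3 * s ^+ 2)) => e e0 e1.
  have := key' (1 + e) ltac:(lra).
  rewrite (_ : 1 + e - 1 = e); last by ring.
  rewrite [v * _]mulrCA [X in _ <= X]mulrC ler_pM2l//.
  move: v0 s2; set S := s ^+ 2 => v0 s2 h; nra.
apply: (@ler_addgt0_mul R _ _ (2 * s ^+ 2)) => e e0 e1.
have := key' (1 - e) ltac:(lra).
rewrite (_ : 1 - e - 1 = - e); last by ring.
rewrite [v * _]mulrCA [X in _ <= X]mulrC ler_nM2l ?oppr_lt0//.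
move: v0 s2; set S := s ^+ 2 => v0 s2 h; nra.
Qed.

(** Same squeeze as for the second moment, with exponents of both signs in
    [normal_exp]. *)
Lemma normal_moment1 (s : R) : 0 < s -> \int[normal_prob 0 s]_x x = 0.
Proof.
move=> s0; set v := (X in X = _).
have i1 := normal_integrable_id s0.
have key t : 1 + t * v <= expR (t ^+ 2 * s ^+ 2 / 2).
  have mE : measurable_fun setT (fun x : R => expR (t * x)).
    by apply: measurableT_comp => //; exact: measurable_funM.
  have iE : (normal_prob 0 s).-integrable setT (EFin \o (fun x : R => expR (t * x))).
    apply/integrableP; split; first exact/measurable_EFinP.
    under eq_integral do rewrite gee0_abs ?lee_fin ?expR_ge0//.
    by rewrite normal_exp// ltry.
  have iL : (normal_prob 0 s).-integrable setT (EFin \o (fun x : R => t * x)).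
    exact: integrable_EFinZ i1.
  have -> : 1 + t * v = \int[normal_prob 0 s]_x (1 + t * x).
    rewrite RintegralD//; last exact: integrable_EFin_cst.
    by rewrite Rintegral_probability_cst RintegralZl.
  have -> : expR (t ^+ 2 * s ^+ 2 / 2) = \int[normal_prob 0 s]_x (expR (t * x)).
    by rewrite /Rintegral normal_exp.
  apply: le_Rintegral => //; last by move=> x _; exact: expR_ge1Dx.
  by apply: integrable_EFinD => //; exact: integrable_EFin_cst.
have s2 : 0 < s ^+ 2 by rewrite exprn_gt0.
have key' t : t ^+ 2 * s ^+ 2 <= 1 -> t * v <= t ^+ 2 * s ^+ 2.
  move=> h; have := key t; have : expR (t ^+ 2 * s ^+ 2 / 2) <= 1 + 2 * (t ^+ 2 * s ^+ 2 / 2).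
    by apply: expR_le1D2x; first rewrite divr_ge0// mulr_ge0 ?sqr_ge0//; lra.
  lra.
have small e : 0 < e -> e < 1 -> (e / s) ^+ 2 * s ^+ 2 = e ^+ 2.
  by move=> e0 e1; field; rewrite gt_eqF.
apply/eqP; rewrite eq_le; apply/andP; split.
  apply: (@ler_addgt0_mul R _ _ s) => e e0 e1; rewrite add0r.
  have : e / s * v <= e ^+ 2 by rewrite -(small _ e0 e1) key'// small//; nra.
  by rewrite (_ : e / s * v = e * (v / s)) ?expr2 ?ler_pM2l// ?ler_pdivrMr//; field; rewrite gt_eqF.
apply: (@ler_addgt0_mul R _ _ s) => e e0 e1.
have : - (e / s) * v <= e ^+ 2.
  have := key' (- (e / s)); rewrite sqrrN small//; apply; nra.
rewrite (_ : - (e / s) * v = e * ((- v) / s)); last by field; rewrite gt_eqF.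
rewrite expr2 ler_pM2l// ler_pdivrMr// => h; lra.
Qed.

(** Arithmetic-geometric mean between the second and the fourth moment. *)
Lemma normal_norm3 (s : R) : 0 < s ->
  \int[normal_prob 0 s]_x (`|x| ^+ 3) <= 31 * s ^+ 3.
Proof.
move=> s0.
have i2 := normal_integrable_sqr s0.
have i3 := @normal_integrableX s 3 s0 isT.
have i4 : (normal_prob 0 s).-integrable setT (EFin \o (fun x : R => x ^+ 4)).
  apply: (dominated_integrable _ (@normal_integrableX s 4 s0 isT)).
    exact: measurable_funX.
  by move=> x; rewrite normrX.
have m4 : \int[normal_prob 0 s]_x (x ^+ 4) <= 60 * s ^+ 4.
  rewrite -lee_fin /Rintegral fineK; first exact: normal_moment4.
  exact: integrable_fin_num.
have : \int[normal_prob 0 s]_x (`|x| ^+ 3) <=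
   \int[normal_prob 0 s]_x ((2 * s)^-1 * x ^+ 4 + s / 2 * x ^+ 2).
  apply: le_Rintegral => //.
    by apply: integrable_EFinD => //; exact: integrable_EFinZ.
  move=> x _.
  rewrite (_ : x ^+ 4 = `|x| ^+ 4); last by rewrite -normrX ger0_norm ?exprn_even_ge0.
  rewrite (_ : x ^+ 2 = `|x| ^+ 2); last by rewrite -normrX ger0_norm ?exprn_even_ge0.
  have := normr_ge0 x; set y := `|x| => y0.
  rewrite -(ler_pM2l (_ : 0 < 2 * s)); last lra.
  rewrite mulrDr mulVKf; last by rewrite gt_eqF//; lra.
  have := mulr_ge0 (sqr_ge0 y) (sqr_ge0 (y - s)); nra.
move/le_trans; apply.
rewrite RintegralD//; [|exact: integrable_EFinZ|exact: integrable_EFinZ].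
rewrite !RintegralZl// normal_moment2//.
rewrite -(ler_pM2l (_ : 0 < 2 * s)); last lra.
rewrite mulrDr mulVKf; last by rewrite gt_eqF//; lra.
move: m4 (exprn_gt0 4 s0); move: (Rintegral _ _ _) => I; clear -s0; nra.
Qed.

End normal_moments.

(** * Maximal deviation of Brownian motion *)

Section chaining.
Context {R : realType}.

Lemma within_continuous_dist (f : R -> R) s :
  {within `[0, +oo[%classic, continuous f} -> 0 <= s ->
  forall e, 0 < e -> exists2 d, 0 < d &
    forall t, 0 <= t -> `|t - s| < d -> `|f t - f s| < e.
Proof.
move=> /subspace_continuousP cf s0 e e0.
have := cf s; rewrite /= in_itv/= s0 => /(_ isT) /cvgrPdist_lt /(_ e e0).
rewrite near_withinE => /nbhs_ballP[d /= d0 H].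
exists d => // t t0 ts; rewrite distrC.
apply: H; last by rewrite /= in_itv/= t0.
by rewrite /ball/= distrC.
Qed.

(** A dyadic point of level n is reached from 0 through one increment per level,
    and the allowed increments c (1 - r) r^n add up to c. *)
Lemma dyadic_chaining (w : R -> R) (h c r : R) :
  {within `[0, +oo[%classic, continuous w} -> w 0 = 0 -> 0 < h -> 0 <= c ->
  0 < r -> r < 1 ->
  (forall n k, (k < 2 ^ n)%N ->
    `|w (k.+1%:R * (h / 2 ^+ n)) - w (k%:R * (h / 2 ^+ n))| <= c * (1 - r) * r ^+ n) ->
  forall s, 0 <= s -> s <= h -> `|w s| <= c.
Proof.
move=> cw w0 h0 c0 r0 r1 H s s0 sh.
have dyadic n k : (k <= 2 ^ n)%N -> `|w (k%:R * (h / 2 ^+ n))| <= c * (1 - r ^+ n.+1).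
  elim: n k => [|n ih] k.
    rewrite expn0 expr1; case: k => [_|[_|//]].
      by rewrite mul0r w0 normr0 mulr_ge0// subr_ge0 ltW.
    have := H 0%N 0%N isT; rewrite !expr0 mul0r w0 subr0 mulr1.
    by [].
  move=> kn.
  have half j : j.*2%:R * (h / 2 ^+ n.+1) = j%:R * (h / 2 ^+ n) :> R.
    by rewrite -muln2 natrM exprS; field; rewrite expf_neq0.
  (* Halving an index of level n.+1 gives the same point at level n. *)
  have jn : (k./2 <= 2 ^ n)%N.
    by rewrite -(doubleK (2 ^ n)%N) half_leq// -muln2 mulnC -expnS.
  have r1n : r ^+ n.+2 <= r ^+ n.+1 by rewrite exprS ler_piMl// ?exprn_ge0// ltW.
  rewrite -(odd_double_half k); case: (boolP (odd k)) => ok /=; last first.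
    rewrite add0n half (le_trans (ih _ jn))// ler_wpM2l// lerD2l lerN2//.
  have kk : (k./2.*2 < 2 ^ n.+1)%N.
    by have := kn; rewrite -{1}(odd_double_half k) ok.
  rewrite -[X in `|X|](subrK (w (k./2.*2%:R * (h / 2 ^+ n.+1)))).
  rewrite add1n (le_trans (ler_normD _ _))//.
  rewrite (le_trans (lerD (H _ _ kk) (_ : _ <= c * (1 - r ^+ n.+1))))//.
    by rewrite half ih.
  rewrite -mulrA -mulrDr ler_wpM2l// [r ^+ n.+2]exprS; lra.
apply/ler_addgt0Pr => e e0.
have [d d0 Hd] := within_continuous_dist cw s0 e0.
have [n hn] : exists n, h / 2 ^+ n < d.
  exists (Num.truncn (h / d)).
  rewrite ltr_pdivrMr ?exprn_gt0// mulrC -ltr_pdivrMr//.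
  apply: (lt_le_trans (truncnS_gt _)).
  by rewrite -natrX ler_nat ltn_expl.
have hn0 : 0 < h / 2 ^+ n by rewrite divr_gt0// exprn_gt0.
pose k := Num.truncn (s / (h / 2 ^+ n)).
have sh0 : 0 <= s / (h / 2 ^+ n) by rewrite divr_ge0// ltW.
have /andP[k1 k2] := truncn_itv sh0; rewrite -/k in k1 k2.
rewrite ler_pdivlMr// in k1.
rewrite ltr_pdivrMr// -natr1 mulrDl mul1r in k2.
have kn : (k <= 2 ^ n)%N.
  rewrite -(ler_nat R) natrX -(ler_pM2r hn0) (le_trans k1)//.
  by rewrite mulrC divfK// expf_neq0.
have t0 : 0 <= k%:R * (h / 2 ^+ n) by rewrite mulr_ge0// ltW.
have := Hd _ t0; rewrite ler0_norm ?subr_le0// opprB => Hk.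
have := Hk ltac:(lra) => {}Hk.
have := dyadic n k kn.
have rn := exprn_gt0 n.+1 r0.
have cr : 0 <= c * r ^+ n.+1 by rewrite mulr_ge0// ltW.
have := ler_distD (w (k%:R * (h / 2 ^+ n))) (w s) 0; rewrite !subr0.
rewrite distrC; lra.
Qed.

End chaining.

Section brownian_maximal.
Context {R : realType} d (T : measurableType d) (P : probability T R).
Variable W : R -> {RV P >-> R}.
Hypothesis BW : brownian_motion W.

(** Markov's inequality for the fourth power. *)
Lemma normal_tail (s a : R) : 0 < s -> 0 < a ->
  (normal_prob 0 s [set x : R | (a < `|x|)%R] <= (60 * s ^+ 4 / a ^+ 4)%:E)%E.
Proof.
move=> s0 a0.
have mA : measurable [set x : R | (a < `|x|)%R].
  rewrite (_ : [set x : R | _] = (fun x : R => `|x|) @^-1` `]a, +oo[%classic); last first.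
    by apply/seteqP; split => x /=; rewrite in_itv/= andbT.
  by rewrite -[X in measurable X]setTI; apply: (@normr_measurable R setT).
have a4 : 0 < a ^+ 4 by rewrite exprn_gt0.
rewrite EFinM muleC -(@lee_pdivrMl _ (a ^+ 4)^-1) ?invr_gt0// invrK.
apply: le_trans (normal_moment4 s0).
rewrite -[X in (_ * X)%E](_ : \int[normal_prob 0 s]_x (\1_[set x : R | (a < `|x|)%R] x)%:E = _)%E; last first.
  by rewrite integral_indic// setIT.
rewrite -ge0_integralZl//; last first.
- by rewrite lee_fin exprn_ge0// ltW.
- exact/measurable_EFinP/measurable_indic.
apply: ge0_le_integral => //.
- by move=> x _; rewrite -EFinM lee_fin mulr_ge0// exprn_ge0// ltW.
- apply/measurable_EFinP; apply: measurable_funM => //.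
- by apply/measurable_EFinP; exact: measurable_funX.
move=> x _; rewrite -EFinM lee_fin indicE; case: (boolP (x \in _)).
  rewrite inE /= => ax; rewrite mulr1 -[x ^+ 4]ger0_norm ?exprn_even_ge0// normrX.
  by rewrite lerXn2r// ?nnegrE ltW.
by rewrite mulr0 exprn_even_ge0.
Qed.

(** The bad event is that some dyadic increment exceeds its allowance in
    [dyadic_chaining].  At level n there are 2^n increments, each of fourth
    moment O(h^2 4^-n), so a union bound converges as soon as 2 r^4 > 1. *)
Lemma brownian_maximal : exists2 K : R, 0 <= K & forall h c : R, 0 < h -> 0 < c ->
  exists2 B : set T, measurable B /\ (P B <= (K * h ^+ 2 / c ^+ 4)%:E)%E &
    forall w, ~ B w -> forall s, 0 <= s -> s <= h -> `|W s w| <= c.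
Proof.
(* Any r < 1 with 2 r^4 > 1 would do. *)
pose r : R := 9 / 10.
have r0 : 0 < r by rewrite /r; lra.
have r1 : r < 1 by rewrite /r; lra.
pose q : R := (2 * r ^+ 4)^-1.
have q0 : 0 <= q by rewrite invr_ge0 mulr_ge0// exprn_ge0// ltW.
have q1 : q < 1.
  rewrite invf_lt1 ?mulr_gt0 ?exprn_gt0// /r; lra.
exists (60 / (1 - r) ^+ 4 / (1 - q)).
  by rewrite !divr_ge0 ?exprn_ge0// subr_ge0 ltW.
move=> h c h0 c0.
pose lev n := c * (1 - r) * r ^+ n.
have lev0 n : 0 < lev n by rewrite !mulr_gt0 ?exprn_gt0// subr_gt0.
pose A n := [set x : R | (lev n < `|x|)%R].
have mA n : measurable (A n).
  rewrite (_ : A n = (fun x : R => `|x|) @^-1` `]lev n, +oo[%classic); last first.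
    by apply/seteqP; split => x /=; rewrite in_itv/= andbT.
  by rewrite -[X in measurable X]setTI; apply: (@normr_measurable R setT).
pose E n k := [set w | A n (W (k.+1%:R * (h / 2 ^+ n)) w - W (k%:R * (h / 2 ^+ n)) w)].
have mE n k : measurable (E n k).
  rewrite (_ : E n k = (W (k.+1%:R * (h / 2 ^+ n)) \- W (k%:R * (h / 2 ^+ n))) @^-1` A n)//.
  rewrite -[X in measurable X]setTI.
  exact: (measurable_funB (measurable_funPT _) (measurable_funPT _)).
pose a := 60 * h ^+ 2 / (c * (1 - r)) ^+ 4.
have PE n k : (P (E n k) <= (a * q ^+ n / 2 ^+ n)%:E)%E.
  have hn0 : 0 < h / 2 ^+ n by rewrite divr_gt0// exprn_gt0.
  rewrite /E (brownian_normal BW)//; first last.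
  - by rewrite ltr_pM2r// ltr_nat.
  - by rewrite mulr_ge0// ltW.
  rewrite (_ : _ - _ = h / 2 ^+ n); last by rewrite -mulrBl -natr1 addrAC subrr add0r mul1r.
  apply: (le_trans (normal_tail _ (lev0 n))); first by rewrite sqrtr_gt0.
  rewrite lee_fin (_ : Num.sqrt (h / 2 ^+ n) ^+ 4 = (h / 2 ^+ n) ^+ 2); last first.
    by rewrite (exprM _ 2 2) sqr_sqrtr// ltW.
  rewrite le_eqVlt; apply/orP; left; apply/eqP.
  have -> : q ^+ n = (2 ^+ n * (r ^+ n) ^+ 4)^-1 by rewrite exprVn exprMn exprAC.
  rewrite /a /lev.
  have := exprn_gt0 n r0; move: (r ^+ n) => v v0.
  have := exprn_gt0 n (@ltr0Sn R 1); move: (2 ^+ n) => u u0.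
  by field; rewrite !gt_eqF ?subr_gt0.
pose F n := \big[setU/set0]_(k < 2 ^ n) E n k.
have mF n : measurable (F n) by exact: bigsetU_measurable.
exists (\bigcup_n F n).
  split; first exact: bigcupT_measurable.
  apply: (@le_trans _ _ (\sum_(n <oo) P (F n))%E).
    by apply: measure_sigma_subadditive => //; exact: bigcupT_measurable.
  apply: lime_le; first by apply: is_cvg_nneseries.
  apply: nearW => n.
  apply: (@le_trans _ _ (\sum_(0 <= i < n) (a * q ^+ i)%:E)%E).
    apply: lee_sum => i _.
    apply: (@le_trans _ _ (\sum_(k < 2 ^ i) P (E i k))%E).
      exact: (@content_subadditive _ _ _ P (F i) (E i) (2 ^ i)%N).
    apply: (@le_trans _ _ (\sum_(k < 2 ^ i) (a * q ^+ i / 2 ^+ i)%:E)%E).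
      by apply: lee_sum.
    rewrite sumEFin lee_fin sumr_const card_ord -[X in X <= _]mulr_natr natrX.
    by rewrite divfK// expf_neq0.
  rewrite sumEFin lee_fin.
  have -> : \sum_(0 <= i < n) (a * q ^+ i) = a * (1 - q ^+ n) / (1 - q).
    elim: n => [|n ih]; first by rewrite big_geq// expr0 subrr mulr0 mul0r.
    rewrite big_nat_recr//= ih exprS; field; rewrite subr_eq0 gt_eqF//.
  have -> : 60 / (1 - r) ^+ 4 / (1 - q) * h ^+ 2 / c ^+ 4 = a / (1 - q).
    rewrite /a; field; rewrite !subr_eq0 !gt_eqF//.
  rewrite ler_pM2r ?invr_gt0 ?subr_gt0//.
  rewrite ler_piMr//; last by rewrite gerBl exprn_ge0.
  by rewrite divr_ge0 ?exprn_even_ge0// mulr_ge0 ?sqr_ge0.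
move=> w nB s s0 sh.
refine (@dyadic_chaining R (fun t => W t w) h c r (@brownian_continuous _ _ _ _ _ BW w) (brownian0 BW w) h0 (ltW c0) r0 r1 _ s s0 sh).
move=> n k kn; rewrite leNgt; apply/negP => H; apply: nB.
exists n => //; rewrite /F -bigcup_mkord; exists k => //.
Qed.

End brownian_maximal.

(** * The regulator of a reflected path *)

Section regulator.
Context {R : realType}.
Implicit Types (l x y : R -> R).

Lemma locally_constant_eq l (a b : R) : a < b -> 0 <= a ->
  {within `[0, +oo[%classic, continuous l} ->
  (forall t, a < t -> t < b -> \forall s \near t, 0 <= s -> l s = l t) ->
  l b = l a.
Proof.
move=> ab a0 cl H.
have [||c _ /eqP] := @MVT R l (cst 0) a b ab.
- move=> t; rewrite in_itv/= => /andP[at_ tb].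
  apply: (@near_eq_is_derive _ _ _ (cst (l t))).
    have := H t at_ tb.
    have t0 : \forall s \near t, 0 < s by apply: lt_nbhsr; exact: le_lt_trans at_.
    by apply: filterS2 t0 => s s0 /(_ (ltW s0)) ->.
- apply: continuous_subspaceW cl => t /=; rewrite !in_itv/= andbT => /andP[at_ _].
  exact: le_trans at_.
by rewrite mul0r subr_eq0 => /eqP.
Qed.

(** A path started above e cannot touch 0, so the regulator stays at 0.  A path
    started below e ends below 3 e: after the last time tau at which it is at
    most e the regulator is constant, and the free path moves by at most 2 e. *)
Lemma small_oscillation_reflection l x y (y0 h e : R) :
  0 < h -> 0 < e ->
  {within `[0, +oo[%classic, continuous l} ->
  {within `[0, +oo[%classic, continuous y} ->
  l 0 = 0 -> (forall s t, 0 <= s -> s <= t -> l s <= l t) ->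
  (forall s, 0 <= s -> y s = y0 + x s + l s) ->
  (forall s, 0 <= s -> s <= h -> `|x s| <= e) ->
  (forall t, 0 <= t -> 0 < y t -> \forall s \near t, 0 <= s -> l s = l t) ->
  x 0 = 0 ->
  (e < y0 -> l h = 0) /\ (y0 <= e -> y h <= 3 * e).
Proof.
move=> h0 e0 cl cy l0 lnd yE xe flat x0; split=> [ey0|y0e].
  rewrite -l0; apply: locally_constant_eq => // t t0 th.
  apply: flat; first exact: ltW.
  rewrite yE ?ltW//; have := xe t (ltW t0) (ltW th); rewrite ler_norml => /andP[? ?].
  have := lnd 0 t (lexx _) (ltW t0); rewrite l0; lra.
rewrite leNgt; apply/negP => yh.
pose S := [set s : R | 0 <= s <= h /\ y s <= e].
have S0 : S 0 by rewrite /S/= lexx ltW// yE// x0 l0; split => //; lra.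
have hS : has_sup S.
  by split; [exists 0|exists h => s [/andP[]]].
pose tau := sup S.
have tau0 : 0 <= tau by apply: ub_le_sup S0; exact: hS.2.
have tauh : tau <= h by apply: ge_sup; [exists 0|move=> s [/andP[]]].
have ytau : y tau <= e.
  apply/ler_addgt0Pr => d d0.
  have [r r0 Hr] := within_continuous_dist cy tau0 d0.
  have [s [/andP[s0 sh] ys] stau] := sup_adherent r0 hS.
  have st : s <= tau by apply: ub_le_sup; [exact: hS.2|split => //; rewrite s0].
  have := Hr s s0; rewrite ler0_norm ?subr_le0// opprB.
  move=> /(_ ltac:(rewrite -/tau in stau; lra)); rewrite ltr_norml => /andP[]; lra.
have tau_lt : tau < h.
  by rewrite lt_neqAle tauh andbT; apply: contraTneq yh => <-; rewrite -leNgt; lra.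
have lE : l h = l tau.
  apply: locally_constant_eq => // t taut th.
  have t0 : 0 <= t by exact: le_trans (ltW taut).
  apply: flat => //; rewrite ltNge; apply/negP => yt.
  have : t <= tau by apply: ub_le_sup; [exact: hS.2|split; [rewrite t0 ltW|lra]].
  by rewrite leNgt taut.
have := yE h (ltW h0); have := yE tau tau0.
have := xe _ tau0 tauh; have := xe _ (ltW h0) (lexx h).
rewrite !ler_norml => /andP[? ?] /andP[? ?]; rewrite lE; lra.
Qed.

End regulator.

(** * Expectations over one short time step *)

Section independent_pairs.
Context d (T : measurableType d) (R : realType) (P : probability T R).

Definition pair_rv (X Z : {mfun T >-> R}) w : R * R := (X w, Z w).

Let measurable_pair_rv (X Z : {mfun T >-> R}) : measurable_fun setT (pair_rv X Z).
Proof. by apply/measurable_fun_pairP; split => /=; exact: measurable_funPT. Qed.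

HB.instance Definition _ (X Z : {mfun T >-> R}) :=
  isMeasurableFun.Build _ _ _ _ (pair_rv X Z) (measurable_pair_rv X Z).

Lemma Rintegral_law d' (S : measurableType d') (X : {mfun T >-> S})
    (nu : {measure set S -> \bar R}) (f : S -> R) (M : R) :
  measurable_fun setT f -> (forall x, `|f x| <= M) ->
  (forall A, measurable A -> P (X @^-1` A) = nu A) ->
  \int[P]_w f (X w) = \int[nu]_x f x.
Proof.
move=> mf fM XQ; rewrite /Rintegral; congr fine.
rewrite -(@eq_measure_integral _ _ _ setT nu (distribution P X)); last first.
  by move=> A mA _; rewrite -XQ.
rewrite integral_distribution//; first exact/measurable_EFinP.
by apply: (@bounded_integrable _ _ _ P (f \o X) M); [exact: measurableT_comp|move=> x; exact: fM].
Qed.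

(** The product rule identifies the law of the pair with the product measure, and
    Fubini's theorem separates the variables. *)
Lemma Rintegral_independent (X Z : {mfun T >-> R}) (Q N : probability R R)
    (F : R * R -> R) (M : R) :
  measurable_fun setT F -> (forall x, `|F x| <= M) ->
  (forall A B, measurable A -> measurable B ->
    P (X @^-1` A `&` Z @^-1` B) = (Q A * N B)%E) ->
  \int[P]_w F (X w, Z w) = \int[Q]_x \int[N]_z F (x, z).
Proof.
move=> mF FM XZ.
have := @Rintegral_law _ _ (pair_rv X Z) (Q \x N)%E F M mF FM.
rewrite /pair_rv /= => ->; last first.
  move=> A mA; rewrite -[LHS]/(distribution P (pair_rv X Z) A).
  by apply/esym; apply: product_measure_unique => //= B C mB mC; rewrite -XZ.
have iF : (Q \x N)%E.-integrable setT (EFin \o F) by exact: bounded_integrable FM.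
rewrite {1}/Rintegral -(integral12_prod_meas1 iF)/= /Rintegral.
congr fine; apply: eq_integral => x _.
rewrite fineK//; apply: integrable_fin_num => //.
apply: (@bounded_integrable _ _ _ N (fun z => F (x, z)) M) => //.
exact: measurableT_comp.
Qed.

End independent_pairs.

Lemma integrable_inner_Rintegral d1 d2 (S1 : measurableType d1) (S2 : measurableType d2)
    (R : realType) (Q : probability S1 R) (N : probability S2 R) (F : S1 * S2 -> R) (M : R) :
  measurable_fun setT F -> (forall x, `|F x| <= M) ->
  Q.-integrable setT (EFin \o (fun x => \int[N]_z F (x, z))).
Proof.
move=> mF FM.
have iF : (Q \x N)%E.-integrable setT (EFin \o F) by exact: bounded_integrable FM.
have := integrable_fubini_F iF.
rewrite (_ : fubini_F _ _ = EFin \o (fun x => \int[N]_z F (x, z)))//.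
apply/funext => x; rewrite /fubini_F /= /Rintegral fineK//.
apply: integrable_fin_num => //.
apply: (@bounded_integrable _ _ _ N (fun z => F (x, z)) M) => //.
exact: measurableT_comp.
Qed.

Section small_gaussian_step.
Context {R : realType}.
Variables (f f1 f2 : R -> R) (M K : R).
Hypotheses (mf : measurable_fun setT f)
  (fM : forall x, `|f x| <= M) (f2M : forall x, `|f2 x| <= M)
  (taylor : forall y u, `|f (y + u) - f y - f1 y * u - f2 y * u ^+ 2 / 2| <= K * `|u| ^+ 3).
Variables (b sigma : R).

(** The first two moments of [b * s ^+ 2 + sigma * x] reproduce the generator
    times the elapsed time [s ^+ 2]; what is left is of order [s ^+ 3], from the
    drift squared and the third absolute moment. *)
Lemma gaussian_step (y s : R) : 0 < s -> s <= 1 ->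
  `|\int[normal_prob 0 s]_x f (y + (b * s ^+ 2 + sigma * x)) - f y
    - s ^+ 2 * (b * f1 y + sigma ^+ 2 / 2 * f2 y)|
  <= s ^+ 3 * (M * b ^+ 2 + 4 * K * (`|b| ^+ 3 + 31 * `|sigma| ^+ 3)).
Proof.
move=> s0 s1.
set N := normal_prob 0 s.
pose xi x := b * s ^+ 2 + sigma * x.
have K0 : 0 <= K.
  by have := taylor 0 1; rewrite normr1 !expr1n !mulr1; exact: le_trans (normr_ge0 _).
have M0 : 0 <= M by exact: le_trans (normr_ge0 _) (fM 0).
have i1 := @normal_integrable_id R s s0.
have i2 := @normal_integrable_sqr R s s0.
have i3 := @normal_integrableX R s 3 s0 isT.
have mxi : measurable_fun setT xi by apply: measurable_funD => //; exact: measurable_funM.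
have ixi : N.-integrable setT (EFin \o xi).
  by apply: integrable_EFinD; [exact: integrable_EFin_cst|exact: integrable_EFinZ].
have ixi2 : N.-integrable setT (EFin \o (fun x => xi x ^+ 2)).
  rewrite (_ : (fun x => xi x ^+ 2) = (fun x => ((b * s ^+ 2) ^+ 2 + 2 * (b * s ^+ 2) * sigma * x) + sigma ^+ 2 * x ^+ 2)); last first.
    by apply/funext => x; rewrite /xi; ring.
  apply: integrable_EFinD; last exact: integrable_EFinZ.
  by apply: integrable_EFinD; [exact: integrable_EFin_cst|exact: integrable_EFinZ].
have if_ : N.-integrable setT (EFin \o (fun x => f (y + xi x))).
  apply: (@bounded_integrable _ _ _ N _ M) => //.
  by apply: measurableT_comp => //; exact: measurable_funD.
have Exi : \int[N]_x xi x = b * s ^+ 2.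
  rewrite RintegralD//; [|exact: integrable_EFin_cst|exact: integrable_EFinZ].
  by rewrite Rintegral_probability_cst RintegralZl// normal_moment1// mulr0 addr0.
have Exi2 : \int[N]_x (xi x ^+ 2) = (b * s ^+ 2) ^+ 2 + sigma ^+ 2 * s ^+ 2.
  rewrite (_ : (fun x => xi x ^+ 2) = (fun x => ((b * s ^+ 2) ^+ 2 + 2 * (b * s ^+ 2) * sigma * x) + sigma ^+ 2 * x ^+ 2)); last first.
    by apply/funext => x; rewrite /xi; ring.
  rewrite RintegralD//; last 2 first.
  - by apply: integrable_EFinD; [exact: integrable_EFin_cst|exact: integrable_EFinZ].
  - exact: integrable_EFinZ.
  rewrite RintegralD//; [|exact: integrable_EFin_cst|exact: integrable_EFinZ].
  by rewrite Rintegral_probability_cst !RintegralZl// normal_moment1// normal_moment2// mulr0 addr0.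
pose g x := f (y + xi x) - f y - f1 y * xi x - f2 y * xi x ^+ 2 / 2.
have gE : g = (fun x => f (y + xi x) + (- f y + ((- f1 y) * xi x + (- f2 y / 2) * xi x ^+ 2))).
  by apply/funext => x; rewrite /g; lra.
have ilast : N.-integrable setT (EFin \o (fun x => (- f1 y) * xi x + (- f2 y / 2) * xi x ^+ 2)).
  by apply: integrable_EFinD; exact: integrable_EFinZ.
have ilast2 : N.-integrable setT (EFin \o (fun x => - f y + ((- f1 y) * xi x + (- f2 y / 2) * xi x ^+ 2))).
  by apply: integrable_EFinD => //; exact: integrable_EFin_cst.
have ig : N.-integrable setT (EFin \o g) by rewrite gE; exact: integrable_EFinD.
have Eg : \int[N]_x g x = \int[N]_x f (y + xi x) - f y - f1 y * (b * s ^+ 2)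
    - f2 y / 2 * ((b * s ^+ 2) ^+ 2 + sigma ^+ 2 * s ^+ 2).
  rewrite gE RintegralD// RintegralD//; last exact: integrable_EFin_cst.
  rewrite RintegralD//; [|exact: integrable_EFinZ|exact: integrable_EFinZ].
  by rewrite Rintegral_probability_cst !RintegralZl// Exi Exi2; lra.
have ib : N.-integrable setT (EFin \o (fun x => 4 * K * ((`|b| * s ^+ 2) ^+ 3 + `|sigma| ^+ 3 * `|x| ^+ 3))).
  apply: integrable_EFinZ; apply: integrable_EFinD; first exact: integrable_EFin_cst.
  exact: integrable_EFinZ.
have gb : `|\int[N]_x g x| <= 4 * K * (`|b| ^+ 3 + 31 * `|sigma| ^+ 3) * s ^+ 3.
  apply: le_trans (le_normr_Rintegral measurableT ig) _.
  apply: (@le_trans _ _ (\int[N]_x (4 * K * ((`|b| * s ^+ 2) ^+ 3 + `|sigma| ^+ 3 * `|x| ^+ 3)))).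
    apply: le_Rintegral => //.
      exact: (integrable_norm ig).
    move=> x _; apply: (le_trans (taylor y (xi x))).
    rewrite [4 * K]mulrC -[leRHS]mulrA ler_wpM2l//.
    apply: (@le_trans _ _ ((`|b| * s ^+ 2 + `|sigma| * `|x|) ^+ 3)).
      have bs0 : 0 <= `|b| * s ^+ 2 by rewrite mulr_ge0// sqr_ge0.
      rewrite lerXn2r ?nnegrE ?addr_ge0// ?mulr_ge0//.
      by rewrite /xi (le_trans (ler_normD _ _))// !normrM (gtr0_norm s0).
    rewrite -exprMn.
    have : 0 <= `|b| * s ^+ 2 by rewrite mulr_ge0 ?sqr_ge0.
    have : 0 <= `|sigma| * `|x| by rewrite mulr_ge0.
    move: (`|b| * _) (`|sigma| * _) => u v v0 u0.
    have := mulr_ge0 (addr_ge0 u0 v0) (sqr_ge0 (u - v)); nra.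
  rewrite RintegralZl//; last first.
    by apply: integrable_EFinD; [exact: integrable_EFin_cst|exact: integrable_EFinZ].
  rewrite RintegralD//; [|exact: integrable_EFin_cst|exact: integrable_EFinZ].
  rewrite Rintegral_probability_cst RintegralZl// -[leRHS]mulrA ler_wpM2l ?mulr_ge0//.
  have := normal_norm3 s0; rewrite -/N; move: (\int[N]_x _) => I hI.
  rewrite mulrDl lerD//.
    rewrite exprMn ler_wpM2l ?exprn_ge0// -exprM (_ : (2 * 3)%N = (3 + 3)%N)//.
    by rewrite exprD ler_piMl ?exprn_ge0 ?exprn_ile1// ltW.
  rewrite (_ : 31 * `|sigma| ^+ 3 * s ^+ 3 = `|sigma| ^+ 3 * (31 * s ^+ 3)); last by ring.
  by rewrite ler_wpM2l// exprn_ge0.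
have -> : \int[N]_x f (y + (b * s ^+ 2 + sigma * x)) - f y
    - s ^+ 2 * (b * f1 y + sigma ^+ 2 / 2 * f2 y)
  = \int[N]_x g x + f2 y / 2 * (b * s ^+ 2) ^+ 2.
  by rewrite Eg; lra.
apply: (le_trans (ler_normD _ _)).
rewrite mulrDr addrC lerD//; last by rewrite mulrC.
have -> : `|f2 y / 2 * (b * s ^+ 2) ^+ 2| = s ^+ 3 * (`|f2 y| / 2 * (s * b ^+ 2)).
  rewrite normrM (ger0_norm (sqr_ge0 (b * s ^+ 2))) normrM normfV (ger0_norm (ler0n R 2)).
  by field.
have s3 := exprn_gt0 3 s0.
have := f2M y; have := normr_ge0 (f2 y); have := sqr_ge0 b.
move: (b ^+ 2) (`|f2 y|) => B F B0 F0 FM.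
have : F / 2 * (s * B) <= M * B.
  by rewrite mulrA ler_wpM2r//; nra.
by rewrite ler_pM2l.
Qed.

End small_gaussian_step.

(** The normal law is defined on the Borel space generated by half-open
    intervals and random variables take values in the canonical one.  The two
    have the same measurable sets but are different structures, which the
    identity connects. *)
Definition borel_id (R : realType) (x : measurableTypeR R) : R := x.

Lemma measurable_borel_id (R : realType) :
  measurable_fun setT (@borel_id R).
Proof. by move=> _ A mA; rewrite setTI. Qed.

HB.instance Definition _ (R : realType) :=
  isMeasurableFun.Build _ _ _ _ (@borel_id R) (@measurable_borel_id R).

Definition normal_law {R : realType} (m s : R) : probability R R :=
  distribution (normal_prob m s) (@borel_id R).

Lemma Rintegral_normal_law {R : realType} (m s : R) (f : R -> R) (M : R) :
  measurable_fun setT f -> (forall x, `|f x| <= M) ->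
  \int[normal_law m s]_x f x = \int[normal_prob m s]_x f x.
Proof.
move=> mf fM.
by rewrite -(@Rintegral_law _ _ _ (normal_prob m s) _ _ (@borel_id R) (normal_law m s) f M).
Qed.

(** * Stationarity tested on one short time step *)

Section stationary_generator.
Context {R : realType} d (T : measurableType d) (P : probability T R).
Variables (delta lambda mu : R) (W Y L : R -> {RV P >-> R}).
Hypotheses (delta0 : 0 < delta) (lambda0 : 0 < lambda) (mu0 : 0 < mu).
Hypothesis rbm : reflected_brownian_motion delta lambda mu W Y L.
Variable nu : probability R R.
Hypothesis stat : forall (t : R) (A : set R), 0 <= t -> measurable A ->
  distribution P (Y t) A = nu A.

Let b := delta * (lambda - mu).
Let sigma := delta * Num.sqrt (lambda + mu).

Variables (f f1 f2 : R -> R) (M K : R).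
Hypotheses (mf : measurable_fun setT f) (mf1 : measurable_fun setT f1)
  (mf2 : measurable_fun setT f2)
  (fM : forall x, `|f x| <= M) (f1M : forall x, `|f1 x| <= M)
  (f2M : forall x, `|f2 x| <= M)
  (taylor : forall y u,
    `|f (y + u) - f y - f1 y * u - f2 y * u ^+ 2 / 2| <= K * `|u| ^+ 3).

Let G := \int[nu]_y (b * f1 y + sigma ^+ 2 / 2 * f2 y).

Let i1 : nu.-integrable setT (EFin \o f1).
Proof. exact: (@bounded_integrable _ _ _ nu f1 M). Qed.

Let i2 : nu.-integrable setT (EFin \o f2).
Proof. exact: (@bounded_integrable _ _ _ nu f2 M). Qed.

Let iG : nu.-integrable setT (EFin \o (fun y => b * f1 y + sigma ^+ 2 / 2 * f2 y)).
Proof. by apply: integrable_EFinD; exact: integrable_EFinZ. Qed.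

Let free (h : R) w := Y 0 w + (b * h + sigma * W h w).

Let mfree h : measurable_fun setT (free h).
Proof.
apply: measurable_funD; first exact: measurable_funPT.
apply: measurable_funD => //; apply: measurable_funM => //; exact: measurable_funPT.
Qed.

Lemma rbm_initial_driver_independent (s : R) (A B : set R) : 0 < s ->
  measurable A -> measurable B ->
  P (Y 0 @^-1` A `&` W (s ^+ 2) @^-1` B) = (nu A * normal_prob 0 s B)%E.
Proof.
move=> s0 mA mB; rewrite (rbm_indep rbm)//; last first.
  apply: sub_sigma_algebra; exists (s ^+ 2); first exact: sqr_ge0.
  by exists B => //; rewrite setTI.
congr (_ * _)%E; first exact: stat.
have := @brownian_normal _ _ _ _ _ (rbm_driver rbm) 0 (s ^+ 2) B (lexx _) (exprn_gt0 2 s0) mB.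
rewrite subr0 sqrtr_sqr gtr0_norm// => <-.
congr (P _); apply/seteqP; split => w /=;
  by rewrite (brownian0 (rbm_driver rbm)) subr0.
Qed.

(** Time is parametrised as [s ^+ 2], so that the standard deviation of the
    driving increment is s.  The bound of [gaussian_step] is uniform in the
    starting point and can be integrated against the stationary law. *)
Lemma free_step : exists C : R, forall s, 0 < s -> s <= 1 ->
  `|\int[P]_w f (free (s ^+ 2) w) - \int[nu]_y f y - s ^+ 2 * G| <= C * s ^+ 3.
Proof.
exists (M * b ^+ 2 + 4 * K * (`|b| ^+ 3 + 31 * `|sigma| ^+ 3)) => s s0 s1.
set C := (X in _ <= X * _).
pose F (z : R * R) := f (z.1 + (b * s ^+ 2 + sigma * z.2)).
have mF : measurable_fun setT F.
  apply: measurableT_comp => //; apply: measurable_funD => //.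
  by apply: measurable_funD => //; exact: measurable_funM.
have -> : \int[P]_w f (free (s ^+ 2) w) =
    \int[nu]_y \int[normal_prob 0 s]_x f (y + (b * s ^+ 2 + sigma * x)).
  have -> := @Rintegral_independent _ _ _ P (Y 0) (W (s ^+ 2)) nu (normal_law 0 s) F M mF
    (fun z => fM _) (fun A B mA mB => rbm_initial_driver_independent s0 mA mB).
  apply: eq_Rintegral => y _; rewrite (@Rintegral_normal_law _ _ _ _ M)//.
    exact: measurableT_comp.
  by move=> z; exact: fM.
set I := fun y => \int[normal_prob 0 s]_x f (y + (b * s ^+ 2 + sigma * x)).
have inner y : (normal_prob 0 s).-integrable setT (EFin \o (fun x => f (y + (b * s ^+ 2 + sigma * x)))).
  apply: (@bounded_integrable _ _ _ _ _ M); last by move=> x; exact: fM.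
  apply: measurableT_comp => //; apply: measurable_funD => //.
  by apply: measurable_funD => //; exact: measurable_funM.
have IM y : `|I y| <= M.
  apply: (le_trans (le_normr_Rintegral measurableT (inner y))).
  rewrite -[leRHS](Rintegral_probability_cst (normal_prob 0 s)).
  apply: le_Rintegral => //; [exact: (integrable_norm (inner y))|exact: integrable_EFin_cst].
have iI : nu.-integrable setT (EFin \o I).
  have -> : I = (fun y => \int[normal_prob 0 s]_x F (y, x)) by [].
  apply: (@integrable_inner_Rintegral _ _ _ _ _ nu (normal_prob 0 s) F M mF) => z; exact: fM.
have if_ : nu.-integrable setT (EFin \o f) by exact: (@bounded_integrable _ _ _ nu f M).
rewrite -RintegralZl// -RintegralB//= -RintegralB//; last 2 first.
- have := integrableB measurableT iI if_; exact.
- exact: integrable_EFinZ.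
have iall : nu.-integrable setT (EFin \o (fun y => I y - f y - s ^+ 2 * (b * f1 y + sigma ^+ 2 / 2 * f2 y))).
  have := integrableB measurableT (integrableB measurableT iI if_) (integrable_EFinZ (s ^+ 2) iG); exact.
apply: (le_trans (le_normr_Rintegral measurableT iall)).
rewrite -[leRHS](Rintegral_probability_cst nu).
apply: le_Rintegral => //; [exact: (integrable_norm iall)|exact: integrable_EFin_cst|].
by move=> y _; rewrite [C * _]mulrC; exact: (gaussian_step mf fM f2M taylor).
Qed.

Let stationary_f t : 0 <= t -> \int[P]_w f (Y t w) = \int[nu]_y f y.
Proof.
move=> t0; apply: (@Rintegral_law _ _ _ _ _ _ (Y t) _ _ M) => //.
by move=> A mA; exact: stat.
Qed.

Let iY t : P.-integrable setT (EFin \o (fun w => f (Y t w))).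
Proof.
apply: (@bounded_integrable _ _ _ _ _ M); last by move=> x; exact: fM.
by apply: measurableT_comp => //; exact: measurable_funPT.
Qed.

Let ifree h : P.-integrable setT (EFin \o (fun w => f (free h w))).
Proof.
apply: (@bounded_integrable _ _ _ _ _ M); last by move=> x; exact: fM.
exact: measurableT_comp.
Qed.

Let YE t w : 0 <= t -> Y t w = free t w + L t w.
Proof. by move=> t0; rewrite (rbm_eq rbm)// /free /b /sigma !addrA. Qed.

(** The regulator is nonnegative: reflection can only increase a nondecreasing
    test function. *)
Lemma stationary_generator_le0 : (forall x y, x <= y -> f x <= f y) -> G <= 0.
Proof.
move=> fnd; have [C HC] := free_step.
apply: (@ler_addgt0_mul _ _ _ C) => s s0 s1; rewrite add0r.
have s2 := exprn_gt0 2 s0.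
have := HC s s0 (ltW s1).
rewrite -(stationary_f (ltW s2)).
have le : \int[P]_w f (free (s ^+ 2) w) <= \int[P]_w f (Y (s ^+ 2) w).
  apply: le_Rintegral => // w _; apply: fnd; rewrite [leRHS](YE w (ltW s2)) lerDl.
  by rewrite -(rbm_regulator0 rbm w); apply: (rbm_regulator_nondecreasing rbm) => //; exact: ltW.
rewrite ler_norml => /andP[+ _].
move=> H; rewrite -(ler_pM2l s2); move: H le.
rewrite (_ : C * s ^+ 3 = s ^+ 2 * (s * C)); last by ring.
lra.
Qed.

Let continuous_Y w : {within `[0, +oo[%classic, continuous (fun t => Y t w)}.
Proof.
have cW := @brownian_continuous _ _ _ _ _ (rbm_driver rbm) w.
have cL := @rbm_regulator_continuous _ _ _ _ _ _ _ _ _ _ rbm w.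
apply/subspace_continuousP => t /=; rewrite in_itv/= andbT => t0.
have wW : W s w @[s --> within `[0, +oo[%classic (nbhs t)] --> W t w.
  by move/subspace_continuousP : cW; apply; rewrite /= in_itv/= t0.
have wL : L s w @[s --> within `[0, +oo[%classic (nbhs t)] --> L t w.
  by move/subspace_continuousP : cL; apply; rewrite /= in_itv/= t0.
have H : free s w + L s w @[s --> within `[0, +oo[%classic (nbhs t)] --> free t w + L t w.
  apply: cvgD => //; apply: cvgD; first exact: cvg_cst.
  apply: cvgD; apply: cvgM => //; try exact: cvg_cst.
  apply: cvg_within_filter; exact: cvg_id.
suff : Y s w @[s --> within `[0, +oo[%classic (nbhs t)] --> Y t w by [].
rewrite (YE w t0); apply: cvg_trans H; apply: near_eq_cvg.
rewrite near_withinE; near=> s; rewrite /= in_itv/= andbT => s0.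
by rewrite YE.
Unshelve. all: by end_near.
Qed.

(** Off an event of probability O(s^4) the oscillation of the free path is at
    most e; there [small_oscillation_reflection] leaves the choice between no
    reflection at all and both end points in the region where f vanishes. *)
Lemma stationary_generator_eq0 (e : R) : 0 < e ->
  (forall x, x <= 3 * e -> f x = 0) -> G = 0.
Proof.
move=> e0 fe; have [C HC] := free_step.
have [Km Km0 HK] := brownian_maximal (rbm_driver rbm).
have sg0 : 0 < sigma by rewrite /sigma mulr_gt0// sqrtr_gt0 addr_gt0.
have M0 : 0 <= M by exact: le_trans (normr_ge0 _) (fM 0).
(* Half of the allowed oscillation e is for the Brownian part, half for the
   drift. *)
pose c := e / 2 / sigma.
have c0 : 0 < c by rewrite !divr_gt0.
have sgc : sigma * c = e / 2 by rewrite /c mulrC divfK// gt_eqF.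
pose C' := 2 * M * (Km / c ^+ 4).
have C'0 : 0 <= C' by rewrite !mulr_ge0// invr_ge0 exprn_ge0// ltW.
pose s1 : R := Num.min 1 (e / 2 / (`|b| + 1)).
have b1 : 0 < `|b| + 1 by rewrite ltr_wpDl.
have s10 : 0 < s1 by rewrite lt_min ltr01 !divr_gt0.
have key s : 0 < s -> s <= s1 -> `|s ^+ 2 * G| <= s ^+ 3 * (`|C| + C').
  move=> s0 ss1.
  have [sle1 sle2] : s <= 1 /\ s <= e / 2 / (`|b| + 1).
    by move: ss1; rewrite le_min => /andP[].
  have h0 := exprn_gt0 2 s0.
  have hs : s ^+ 2 <= s by rewrite expr2 ler_piMl// ltW.
  have bh : `|b| * s ^+ 2 <= e / 2.
    apply: (@le_trans _ _ ((`|b| + 1) * s)).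
      by apply: ler_pM => //; [exact: sqr_ge0|rewrite lerDl].
    by rewrite mulrC -ler_pdivlMr.
  have [B [mB PB] HB] := HK _ _ h0 c0.
  have agree w : ~ B w -> f (free (s ^+ 2) w) = f (Y (s ^+ 2) w).
    move=> nB.
    pose x t := b * t + sigma * W t w.
    have xe t : 0 <= t -> t <= s ^+ 2 -> `|x t| <= e.
      move=> t0 th; rewrite (le_trans (ler_normD _ _))// (normrM b t) (normrM sigma) (ger0_norm t0).
      rewrite (gtr0_norm sg0).
      have : `|b| * t <= `|b| * s ^+ 2 by rewrite ler_wpM2l.
      have : sigma * `|W t w| <= sigma * c by rewrite ler_pM2l// HB.
      rewrite sgc; lra.
    have [] := @small_oscillation_reflection R (fun t => L t w) x (fun t => Y t w)
      (Y 0 w) (s ^+ 2) e h0 e0 _ (@continuous_Y w).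
    - exact: (rbm_regulator_continuous rbm).
    - exact: (rbm_regulator0 rbm).
    - by move=> ? ?; exact: (rbm_regulator_nondecreasing rbm).
    - by move=> t t0; rewrite YE.
    - exact: xe.
    - by move=> t; exact: (rbm_flat rbm).
    - by rewrite /x (brownian0 (rbm_driver rbm)) !mulr0 addr0.
    have [ey|ey] := ltP e (Y 0 w).
      by move=> /(_ isT) L0 _; rewrite YE ?sqr_ge0// L0 addr0.
    move=> _ /(_ isT) Yh; rewrite !fe//.
    have := xe _ (sqr_ge0 s) (lexx _); rewrite /free -/(x (s ^+ 2)) ler_norml => /andP[_].
    lra.
  have diff : `|\int[P]_w f (free (s ^+ 2) w) - \int[nu]_y f y| <= C' * s ^+ 4.
    rewrite -(stationary_f (ltW h0)) -RintegralB//.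
    have id : P.-integrable setT (EFin \o (fun w => f (free (s ^+ 2) w) - f (Y (s ^+ 2) w))).
      have := integrableB measurableT (ifree (s ^+ 2)) (iY (s ^+ 2)); exact.
    apply: (le_trans (le_normr_Rintegral measurableT id)).
    have iB : P.-integrable setT (EFin \o (fun w => 2 * M * \1_B w)).
      by apply: integrable_EFinZ; exact: integrable_indic.
    apply: (@le_trans _ _ (\int[P]_w (2 * M * \1_B w))).
      apply: le_Rintegral => //; first exact: (integrable_norm id).
      move=> w _; rewrite indicE; case: (boolP (w \in B)) => wB.
        rewrite mulr1 (le_trans (ler_normB _ _))//.
        have := fM (free (s ^+ 2) w); have := fM (Y (s ^+ 2) w); lra.
      by rewrite agree ?subrr ?normr0 ?mulr0//; move: wB; rewrite notin_setE.
    rewrite RintegralZl//; last exact: integrable_indic.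
    rewrite /Rintegral integral_indic// setIT /C' -[leRHS]mulrA ler_wpM2l ?mulr_ge0//.
    rewrite -lee_fin fineK ?fin_num_measure//.
    by rewrite (le_trans PB)// lee_fin -exprM mulrAC.
  have := HC s s0 sle1; move: diff; rewrite !ler_norml.
  set D := _ - _ => /andP[d1 d2] /andP[d3 d4].
  have s3 := exprn_gt0 3 s0.
  have : C' * s ^+ 4 <= s ^+ 3 * C'.
    by rewrite mulrC ler_wpM2r// exprS ler_piMl// ltW.
  have : C * s ^+ 3 <= s ^+ 3 * `|C| by rewrite mulrC ler_pM2l// ler_norm.
  rewrite mulrDr => ? ?; apply/andP; split; lra.
have small : forall s, 0 < s -> s < 1 -> `|G| <= 0 + s * (s1 * (`|C| + C')).
  move=> s s0 slt; rewrite add0r.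
  have ss0 : 0 < s * s1 by rewrite mulr_gt0.
  have ss1 : s * s1 <= s1 by rewrite ler_piMl// ltW.
  have := key (s * s1) ss0 ss1.
  have s2 := exprn_gt0 2 ss0.
  rewrite normrM (ger0_norm (ltW s2)).
  rewrite (_ : (s * s1) ^+ 3 * _ = (s * s1) ^+ 2 * (s * (s1 * (`|C| + C')))); last by ring.
  by rewrite ler_pM2l.
by have := ler_addgt0_mul small; rewrite normr_le0 => /eqP.
Qed.

End stationary_generator.

(** * Truncated-power splines *)

Section spline.
Context {R : realType}.
Implicit Types (z a u x : R).

Definition pos z : R := Num.max z 0.

Lemma posP z : (0 <= z /\ pos z = z) \/ (z <= 0 /\ pos z = 0).
Proof.
have [z0|z0] := leP 0 z; [left|right]; split => //; rewrite /pos.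
- exact: max_l.
- exact: ltW.
- by apply: max_r; exact: ltW.
Qed.

Lemma measurable_pos : measurable_fun setT pos.
Proof. exact: measurable_maxr. Qed.

Lemma pos_cube_taylor a u :
  `|pos (a + u) ^+ 3 - pos a ^+ 3 - 3 * pos a ^+ 2 * u - 6 * pos a * u ^+ 2 / 2| <= `|u| ^+ 3.
Proof.
have [[a0 ->]|[a0 ->]] := posP a; have [[b0 ->]|[b0 ->]] := posP (a + u).
- by rewrite -normrX le_eqVlt; apply/orP; left; apply/eqP; congr `| _ |; field.
- have u0 : u <= 0 by lra.
  rewrite (ler0_norm u0) expr0n /=.
  have -> : 0 - a ^+ 3 - 3 * a ^+ 2 * u - 6 * a * u ^+ 2 / 2 = (- (a + u)) ^+ 3 - (- u) ^+ 3.
    by field.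
  have : 0 <= (- (a + u)) ^+ 3 by rewrite exprn_ge0//; lra.
  have : (- (a + u)) ^+ 3 <= (- u) ^+ 3 by rewrite lerXn2r ?nnegrE//; lra.
  move: ((- (a + u)) ^+ 3) ((- u) ^+ 3) => w v wv w0.
  by rewrite ler_norml; apply/andP; split; lra.
- have u0 : 0 <= u by lra.
  rewrite (ger0_norm u0) !expr0n /= !mulr0 !mul0r !subr0 ger0_norm ?exprn_ge0//.
  by rewrite lerXn2r ?nnegrE//; lra.
- by rewrite !expr0n /= !mulr0 !mul0r !subr0 normr0 exprn_ge0.
Qed.

Lemma pos_sqr_taylor a u : `|pos (a + u) ^+ 2 - pos a ^+ 2 - 2 * pos a * u| <= u ^+ 2.
Proof.
have [[a0 ->]|[a0 ->]] := posP a; have [[b0 ->]|[b0 ->]] := posP (a + u);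
  rewrite ?expr0n /= ler_norml; apply/andP; split; nra.
Qed.

Variable eta : R.
Hypothesis eta0 : 0 < eta.

(** Second differences of truncated powers: f' and f'' for a third difference
    of cubes.  The normalisation is that of the cubic, so [step] increases from
    0 to [6 * eta ^+ 2]. *)
Definition step z := 3 * (pos z ^+ 2 - 2 * pos (z - eta) ^+ 2 + pos (z - 2 * eta) ^+ 2).
Definition tent z := 6 * (pos z - 2 * pos (z - eta) + pos (z - 2 * eta)).
(** A third difference, because it is constant beyond [3 * eta] and therefore
    bounded, as a test function must be when no moment of the stationary law is
    known. *)
Definition ramp z :=
  pos z ^+ 3 - 3 * pos (z - eta) ^+ 3 + 3 * pos (z - 2 * eta) ^+ 3 - pos (z - 3 * eta) ^+ 3.

Lemma tent_ge0 z : 0 <= tent z.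
Proof.
rewrite /tent.
have [[? ->]|[? ->]] := posP z; have [[? ->]|[? ->]] := posP (z - eta);
  have [[? ->]|[? ->]] := posP (z - 2 * eta); lra.
Qed.

Lemma tent_le z : tent z <= 6 * eta.
Proof.
have e0 := eta0; rewrite /tent.
have [[? ->]|[? ->]] := posP z; have [[? ->]|[? ->]] := posP (z - eta);
  have [[? ->]|[? ->]] := posP (z - 2 * eta); lra.
Qed.

Lemma tent_left z : z <= 0 -> tent z = 0.
Proof.
have e0 := eta0; rewrite /tent => z0.
have [[? ->]|[? ->]] := posP z; have [[? ->]|[? ->]] := posP (z - eta);
  have [[? ->]|[? ->]] := posP (z - 2 * eta); lra.
Qed.

Lemma tent_mid z : eta <= z -> z <= eta + eta / 2 -> 3 * eta <= tent z.
Proof.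
have e0 := eta0; rewrite /tent => z0 z1.
have [[? ->]|[? ->]] := posP z; have [[? ->]|[? ->]] := posP (z - eta);
  have [[? ->]|[? ->]] := posP (z - 2 * eta); lra.
Qed.

Lemma step_left z : z <= 0 -> step z = 0.
Proof.
have e0 := eta0; rewrite /step => z0.
have [[? ->]|[? ->]] := posP z; have [[? ->]|[? ->]] := posP (z - eta);
  have [[? ->]|[? ->]] := posP (z - 2 * eta); nra.
Qed.

Lemma step_right z : 2 * eta <= z -> step z = 6 * eta ^+ 2.
Proof.
have e0 := eta0; rewrite /step => z0.
have [[? ->]|[? ->]] := posP z; have [[? ->]|[? ->]] := posP (z - eta);
  have [[? ->]|[? ->]] := posP (z - 2 * eta); try lra; nra.
Qed.

Lemma step_taylor a u : `|step (a + u) - step a - tent a * u| <= 12 * u ^+ 2.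
Proof.
rewrite /step /tent.
have := pos_sqr_taylor a u; have := pos_sqr_taylor (a - eta) u.
have := pos_sqr_taylor (a - 2 * eta) u.
rewrite (addrAC a (- eta)) (addrAC a (- (2 * eta))).
rewrite !ler_norml => /andP[? ?] /andP[? ?] /andP[? ?].
by apply/andP; split; lra.
Qed.

Lemma step_nondecreasing x y : x <= y -> step x <= step y.
Proof.
apply: (@nondecreasing_of_quadratic _ _ tent 12); last exact: tent_ge0.
by move=> a u _; exact: step_taylor.
Qed.

Lemma step_ge0 z : 0 <= step z.
Proof.
have [z0|/ltW z0] := leP z 0; first by rewrite step_left.
by rewrite -(step_left (lexx 0)) step_nondecreasing.
Qed.

Lemma step_le z : step z <= 6 * eta ^+ 2.
Proof.
have [z0|/ltW z0] := leP (2 * eta) z; first by rewrite step_right.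
by rewrite -(step_right (lexx (2 * eta))) step_nondecreasing.
Qed.

Lemma ramp_taylor a u :
  `|ramp (a + u) - ramp a - (step a - step (a - eta)) * u
    - (tent a - tent (a - eta)) * u ^+ 2 / 2| <= 8 * `|u| ^+ 3.
Proof.
rewrite /ramp /step /tent.
have := pos_cube_taylor a u; have := pos_cube_taylor (a - eta) u.
have := pos_cube_taylor (a - 2 * eta) u; have := pos_cube_taylor (a - 3 * eta) u.
rewrite !(addrAC a _ u).
have -> : a - eta - eta = a - 2 * eta by ring.
have -> : a - eta - 2 * eta = a - 3 * eta by ring.
rewrite !ler_norml => /andP[? ?] /andP[? ?] /andP[? ?] /andP[? ?].
by apply/andP; split; lra.
Qed.

Lemma ramp_left z : z <= 0 -> ramp z = 0.
Proof.
have e0 := eta0; move=> z0; rewrite /ramp.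
have p0 w : w <= 0 -> pos w = 0 by move=> w0; apply: max_r.
by rewrite !p0; [ring|lra..].
Qed.

Lemma ramp_right z : 3 * eta <= z -> ramp z = 6 * eta ^+ 3.
Proof.
have e0 := eta0; move=> z0; rewrite /ramp.
have p0 w : 0 <= w -> pos w = w by move=> w0; apply: max_l.
by rewrite !p0; [ring|lra..].
Qed.

Lemma ramp_nondecreasing x y : x <= y -> ramp x <= ramp y.
Proof.
have e0 := eta0.
apply: (@nondecreasing_of_quadratic _ _ (fun a => step a - step (a - eta)) (8 + 6 * eta)).
  move=> a u u1; have := ramp_taylor a u.
  have := tent_ge0 a; have := tent_ge0 (a - eta); have := tent_le a; have := tent_le (a - eta).
  have : `|u| ^+ 3 <= u ^+ 2.
    rewrite exprS -[u ^+ 2]ger0_norm ?sqr_ge0// normrX ler_piMl ?sqr_ge0//.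
  have := sqr_ge0 u; move: (`|u| ^+ 3) (u ^+ 2) => u3 u2 u20 u32 t1 t2 t3 t4.
  rewrite !ler_norml => /andP[? ?]; apply/andP; split; nra.
by move=> a; rewrite subr_ge0 step_nondecreasing// gerBl ltW.
Qed.

Lemma ramp_ge0 z : 0 <= ramp z.
Proof.
have [z0|/ltW z0] := leP z 0; first by rewrite ramp_left.
by rewrite -(ramp_left (lexx 0)) ramp_nondecreasing.
Qed.

Lemma ramp_le z : ramp z <= 6 * eta ^+ 3.
Proof.
have [z0|/ltW z0] := leP (3 * eta) z; first by rewrite ramp_right.
by rewrite -(ramp_right (lexx (3 * eta))) ramp_nondecreasing.
Qed.

Let mpos a : measurable_fun setT (fun z => pos (z - a)).
Proof. by apply: (measurableT_comp measurable_pos); exact: measurable_funB. Qed.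

Lemma measurable_step : measurable_fun setT step.
Proof.
apply: measurable_funM => //; apply: measurable_funD.
  apply: measurable_funB; first exact: measurable_funX measurable_pos.
  by apply: measurable_funM => //; exact: measurable_funX (mpos _).
exact: measurable_funX (mpos _).
Qed.

Lemma measurable_tent : measurable_fun setT tent.
Proof.
apply: measurable_funM => //; apply: measurable_funD; last exact: mpos.
apply: measurable_funB; first exact: measurable_pos.
by apply: measurable_funM => //; exact: mpos.
Qed.

Lemma measurable_ramp : measurable_fun setT ramp.
Proof.
apply: measurable_funB; last exact: measurable_funX (mpos _).
apply: measurable_funD.
  apply: measurable_funB; first exact: measurable_funX measurable_pos.
  by apply: measurable_funM => //; exact: measurable_funX (mpos _).
by apply: measurable_funM => //; exact: measurable_funX (mpos _).
Qed.

End spline.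

(** * Solving the stationarity identity *)

(** The identity as a random variable on the line, to speak of the tail of a
    law. *)
Definition real_id (R : realType) (x : R) : R := x.

HB.instance Definition _ (R : realType) :=
  isMeasurableFun.Build _ _ _ _ (@real_id R) (@measurable_id _ R setT).

(** The second-order Taylor expansion with cubic remainder is the only form of
    smoothness that one Gaussian step consumes. *)
Definition smooth_test {R : realType} (f f1 f2 : R -> R) :=
  [/\ measurable_fun setT f, measurable_fun setT f1, measurable_fun setT f2 &
    exists M K : R, [/\ forall x, `|f x| <= M, forall x, `|f1 x| <= M,
      forall x, `|f2 x| <= M & forall y u,
      `|f (y + u) - f y - f1 y * u - f2 y * u ^+ 2 / 2| <= K * `|u| ^+ 3] ].

Section exponential_tail.
Context {R : realType}.
Variables (nu : probability R R) (m : R).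
Implicit Types (x y z e u : R) (A B : set R).
Hypotheses (m0 : 0 < m) (nu_neg : nu `]-oo, 0[%classic = 0%E).
Hypothesis gen_le0 : forall f f1 f2 : R -> R, smooth_test f f1 f2 ->
  (forall x y, x <= y -> f x <= f y) -> \int[nu]_y (m * f2 y - f1 y) <= 0.
Hypothesis gen_eq0 : forall (f f1 f2 : R -> R) (e : R), smooth_test f f1 f2 ->
  0 < e -> (forall x, x <= e -> f x = 0) -> \int[nu]_y (m * f2 y - f1 y) = 0.

Let pr (A : set R) := fine (nu A).

Lemma pr_fineK A : measurable A -> (pr A)%:E = nu A.
Proof. by move=> mA; rewrite fineK// fin_num_measure. Qed.

Let pr_le A B : measurable A -> measurable B -> A `<=` B -> pr A <= pr B.
Proof.
move=> mA mB AB; rewrite -lee_fin !pr_fineK//.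
by apply: le_measure => //; rewrite inE.
Qed.

Let pr_le1 A : measurable A -> pr A <= 1.
Proof. by move=> mA; rewrite -lee_fin pr_fineK// probability_le1. Qed.

Let pr_ge0 A : 0 <= pr A.
Proof. exact: fine_ge0. Qed.

Let indic_Rintegral A : measurable A -> \int[nu]_y \1_A y = pr A.
Proof. by move=> mA; rewrite /Rintegral integral_indic// setIT. Qed.

Let le_indic (f : R -> R) (c M : R) A : measurable_fun setT f -> measurable A ->
  (forall x, `|f x| <= M) -> (forall x, f x <= c * \1_A x) ->
  \int[nu]_y f y <= c * pr A.
Proof.
move=> mf mA fM H; rewrite -(indic_Rintegral mA) -RintegralZl//; last exact: integrable_indic.
apply: le_Rintegral => //; last by apply: integrable_EFinZ; exact: integrable_indic.
exact: (@bounded_integrable _ _ _ nu f M).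
Qed.

Let ge_indic (f : R -> R) (c M : R) A : measurable_fun setT f -> measurable A ->
  (forall x, `|f x| <= M) -> (forall x, c * \1_A x <= f x) ->
  c * pr A <= \int[nu]_y f y.
Proof.
move=> mf mA fM H; rewrite -(indic_Rintegral mA) -RintegralZl//; last exact: integrable_indic.
apply: le_Rintegral => //; first by apply: integrable_EFinZ; exact: integrable_indic.
exact: (@bounded_integrable _ _ _ nu f M).
Qed.

Lemma pr_tail_small e : 0 < e -> exists n : nat, pr `]n%:R, +oo[%classic < e.
Proof.
move=> e0.
have /fine_cvgP[_ H] := @cvg_ccdfy0 _ _ _ nu (@real_id R).
have /cvgrPdist_lt /(_ e e0) := H.
move=> -[r [_ Hr]]; exists (Num.truncn r).+1.
have := Hr (Num.truncn r).+1%:R (truncnS_gt r).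
rewrite sub0r normrN ger0_norm//=; exact: fine_ge0.
Qed.

Section fixed_step.
Variable eta : R.
Hypothesis eta0 : 0 < eta.

Local Notation step := (step eta).
Local Notation tent := (tent eta).

Let step_norm x : `|step x| <= 6 * eta ^+ 2.
Proof. by rewrite ger0_norm ?step_le// step_ge0. Qed.

Let tent_norm x : `|tent x| <= 6 * eta.
Proof. by rewrite ger0_norm ?tent_le// tent_ge0. Qed.

Let mstep x : measurable_fun setT (fun y : R => step (y - x)).
Proof. by apply: (measurableT_comp (measurable_step eta)); exact: measurable_funB. Qed.

Let mtent x : measurable_fun setT (fun y : R => tent (y - x)).
Proof. by apply: (measurableT_comp (measurable_tent eta)); exact: measurable_funB. Qed.

Let istep x : nu.-integrable setT (EFin \o (fun y : R => step (y - x))).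
Proof. by apply: (@bounded_integrable _ _ _ nu _ (6 * eta ^+ 2)). Qed.

Let itent x : nu.-integrable setT (EFin \o (fun y : R => tent (y - x))).
Proof. by apply: (@bounded_integrable _ _ _ nu _ (6 * eta)). Qed.

Definition Estep x := \int[nu]_y step (y - x).
Definition Etent x := \int[nu]_y tent (y - x).
Let Phi x := m * Etent x - Estep x.

Lemma ramp_smooth_test x : smooth_test (fun y : R => ramp eta (y - x))
  (fun y : R => step (y - x) - step (y - (x + eta)))
  (fun y : R => tent (y - x) - tent (y - (x + eta))).
Proof.
split.
- by apply: (measurableT_comp (measurable_ramp eta)); exact: measurable_funB.
- exact: measurable_funB.
- exact: measurable_funB.
exists (6 * eta ^+ 3 + 12 * eta ^+ 2 + 12 * eta), 8.
have e3 : 0 < eta ^+ 3 by rewrite exprn_gt0.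
have e2 : 0 < eta ^+ 2 by rewrite exprn_gt0.
have e0 := eta0.
split => [y|y|y|y u].
- rewrite ger0_norm ?ramp_ge0//; have := ramp_le eta0 (y - x); lra.
- rewrite (le_trans (ler_normB _ _))//.
  have := step_norm (y - x); have := step_norm (y - (x + eta)); lra.
- rewrite (le_trans (ler_normB _ _))//.
  have := tent_norm (y - x); have := tent_norm (y - (x + eta)); lra.
have := ramp_taylor eta (y - x) u.
by rewrite (addrAC y u) (_ : y - (x + eta) = y - x - eta)//; ring.
Qed.

(** Testing stationarity on [ramp eta (y - x)] compares the values of Phi at x
    and at x + eta. *)
Let PhiB x : \int[nu]_y (m * (tent (y - x) - tent (y - (x + eta))) -
    (step (y - x) - step (y - (x + eta)))) = Phi x - Phi (x + eta).
Proof.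
have it : nu.-integrable setT (EFin \o (fun y : R => tent (y - x) - tent (y - (x + eta)))).
  by have := integrableB measurableT (itent x) (itent (x + eta)); exact.
have is_ : nu.-integrable setT (EFin \o (fun y : R => step (y - x) - step (y - (x + eta)))).
  by have := integrableB measurableT (istep x) (istep (x + eta)); exact.
rewrite RintegralB//; last exact: integrable_EFinZ.
rewrite RintegralZl// !RintegralB// /Phi /Etent /Estep; lra.
Qed.

Let Phi_nd x : Phi x <= Phi (x + eta).
Proof.
rewrite -subr_le0 -PhiB; apply: gen_le0; first exact: ramp_smooth_test.
by move=> a c ac; apply: ramp_nondecreasing => //; rewrite lerD2r.
Qed.

Let Phi_eq x : 0 < x -> Phi x = Phi (x + eta).
Proof.
move=> x0; apply/eqP; rewrite -subr_eq0 -PhiB; apply/eqP.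
apply: (gen_eq0 (ramp_smooth_test x) x0) => y yx.
by apply: ramp_left => //; rewrite subr_le0.
Qed.

Let tail x := `]x, +oo[%classic : set R.

Let mtail x : measurable (tail x). Proof. exact: measurable_itv. Qed.

Let le_tail (f : R -> R) (c : R) x y : 0 <= c -> (forall z, z <= 0 -> f z = 0) ->
  (forall z, f z <= c) -> f (y - x) <= c * \1_(tail x) y.
Proof.
move=> c0 f0 fc; rewrite indicE; case: (boolP (y \in _)) => [|].
  by rewrite mulr1.
rewrite notin_setE /tail /= in_itv/= andbT => /negP; rewrite -leNgt => yx.
by rewrite f0 ?mulr0// subr_le0.
Qed.

Lemma Estep_upper x : Estep x <= 6 * eta ^+ 2 * pr (tail x).
Proof.
apply: (@le_indic _ _ (6 * eta ^+ 2)) => // y; apply: le_tail => //.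
- by rewrite mulr_ge0// sqr_ge0.
- by move=> z; exact: step_left.
- by move=> z; exact: step_le.
Qed.

Let Etent_le x : Etent x <= 6 * eta * pr (tail x).
Proof.
apply: (@le_indic _ _ (6 * eta)) => // y; apply: le_tail => //.
- by rewrite mulr_ge0// ltW.
- by move=> z; exact: tent_left.
- by move=> z; exact: tent_le.
Qed.

Lemma Estep_ge0 x : 0 <= Estep x.
Proof. by apply: Rintegral_ge0 => y _; exact: step_ge0. Qed.

Lemma Etent_ge0 x : 0 <= Etent x.
Proof. by apply: Rintegral_ge0 => y _; exact: tent_ge0. Qed.

(** Step and tent only see the mass beyond x, so iterating the comparison to
    infinity removes the second term. *)
Let Phi_vanish x e : 0 < e -> exists n : nat, `|Phi (x + n%:R * eta)| <= e.
Proof.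
move=> e0; pose K := m * (6 * eta) + 6 * eta ^+ 2.
have K0 : 0 < K by rewrite addr_gt0// ?mulr_gt0// exprn_gt0.
have [N HN] := pr_tail_small (divr_gt0 e0 K0).
exists (Num.truncn ((N%:R - x) / eta)).+1.
set y := x + _.
have Ny : N%:R <= y.
  have := truncnS_gt ((N%:R - x) / eta); rewrite ltr_pdivrMr// -/y => /ltW.
  by rewrite lerBlDl.
have py : K * pr (tail y) <= e.
  rewrite mulrC -ler_pdivlMr//; apply: le_trans (ltW HN).
  apply: pr_le => //; apply: subset_itvr; by rewrite bnd_simp.
have := Estep_upper y; have := Etent_le y; have := Estep_ge0 y; have := Etent_ge0 y.
rewrite -(ler_pM2l m0); have m0' := m0; rewrite mulr0 => t0 s0.
rewrite -(ler_pM2l m0) /Phi => t1 s1; move: py; rewrite /K mulrDl => py.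
have := mulr_ge0 (ltW (_ : 0 < 6 * eta ^+ 2)) (pr_ge0 (tail y)).
rewrite mulr_gt0 ?exprn_gt0// => /(_ isT) q1.
have q2 : 0 <= m * (6 * eta * pr (tail y)).
  by rewrite !mulr_ge0// ltW.
rewrite ler_norml; apply/andP; split; lra.
Qed.

Lemma Etent_le_Estep x : m * Etent x <= Estep x.
Proof.
rewrite -subr_le0 -/(Phi x); apply/ler_addgt0Pr => e e0; rewrite add0r.
have [n] := Phi_vanish x e0; apply: le_trans.
apply: le_trans (ler_norm _).
elim: n => [|n ih]; first by rewrite mul0r addr0.
by apply: (le_trans ih); rewrite -natr1 mulrDl mul1r addrA.
Qed.

Lemma Etent_eq_Estep x : 0 < x -> m * Etent x = Estep x.
Proof.
move=> x0; apply/eqP; rewrite -subr_eq0 -/(Phi x) -normr_le0.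
apply/ler_addgt0Pr => e e0; rewrite add0r.
have [n] := Phi_vanish x e0; apply: le_trans.
suff -> : Phi (x + n%:R * eta) = Phi x by [].
elim: n => [|n ih]; first by rewrite mul0r addr0.
rewrite -ih -natr1 mulrDl mul1r addrA -Phi_eq//.
by rewrite ltr_wpDr// mulr_ge0// ltW.
Qed.

Lemma is_derive_Estep (x : R) : is_derive x (1 : R) Estep (- Etent x).
Proof.
apply: (@is_derive_quadratic _ _ _ _ 12) => u _.
rewrite mulNr opprK /Estep /Etent -RintegralB// -RintegralZr//.
pose g y := step (y - (x + u)) - step (y - x) + tent (y - x) * u.
have ig : nu.-integrable setT (EFin \o g).
  apply: integrable_EFinD.
    by have := integrableB measurableT (istep (x + u)) (istep x); exact.
  have := integrable_EFinZ u (itent x); congr integrable; apply/funext => y /=.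
  by rewrite mulrC.
rewrite -RintegralD//; last 2 first.
- by have := integrableB measurableT (istep (x + u)) (istep x); exact.
- have := integrable_EFinZ u (itent x); congr integrable; apply/funext => y /=.
  by rewrite mulrC.
apply: (le_trans (le_normr_Rintegral measurableT ig)).
rewrite -[leRHS](Rintegral_probability_cst nu).
apply: le_Rintegral => //; [exact: (integrable_norm ig)|exact: integrable_EFin_cst|].
move=> y _; have := step_taylor eta (y - x) (- u).
by rewrite sqrrN mulrN opprK /g (_ : y - (x + u) = y - x - u)//; ring.
Qed.

(** The function [Estep y * expR (y / m)] has derivative 0 on y > 0 by
    [Etent_eq_Estep], and it is continuous at 0. *)
Lemma Estep_exp x : 0 <= x -> Estep x = Estep 0 * expR (- (x / m)).
Proof.
rewrite le_eqVlt => /predU1P[<-|x0]; first by rewrite mul0r oppr0 expR0 mulr1.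
pose g y := Estep y * expR (y / m).
have dexp (y : R) : is_derive y (1 : R) (fun z => expR (z / m)) (m^-1 * expR (y / m)).
  have d1 : is_derive y (1 : R) (fun z : R => z / m) m^-1.
    apply: (@is_derive_quadratic _ _ _ _ 0) => u _.
    by rewrite mul0r (_ : _ - _ = 0) ?normr0//; ring.
  by have := @is_derive1_comp R expR (fun z : R => z / m) y _ _ (is_derive_expR (y / m)) d1; rewrite mulrC.
have dg (y : R) : is_derive y (1 : R) g (Estep y * (m^-1 * expR (y / m)) + expR (y / m) * (- Etent y)).
  have := is_deriveM (is_derive_Estep y) (dexp y); exact.
have cg : {within `[0, x], continuous g}.
  apply: continuous_subspaceT => z.
  by have [/derivable1_diffP/differentiable_continuous] := dg z.
have [c] := MVT x0 (fun z _ => dg z) cg.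
rewrite in_itv/= => /andP[c0 _].
rewrite -(Etent_eq_Estep c0).
have -> : m * Etent c * (m^-1 * expR (c / m)) + expR (c / m) * - Etent c = 0.
  by field; rewrite gt_eqF.
rewrite mul0r /g mul0r expR0 mulr1 => /eqP; rewrite subr_eq0 => /eqP <-.
by rewrite -mulrA -expRD subrr expR0 mulr1.
Qed.

(** At x = - eta the tent is at least 3 eta on [0, eta / 2], whereas the step is
    never more than 6 eta^2: an atom at 0 would contradict [Etent_le_Estep] for
    small eta. *)
Lemma pr_ball_small : pr `[0, eta / 2]%classic <= 2 * eta / m.
Proof.
have := Etent_le_Estep (- eta).
have h1 : Estep (- eta) <= 6 * eta ^+ 2.
  apply: le_trans (Estep_upper _) _; rewrite ler_piMr ?pr_le1//.
  by rewrite mulr_ge0// sqr_ge0.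
have h2 : 3 * eta * pr `[0, eta / 2]%classic <= Etent (- eta).
  apply: (@ge_indic _ _ (6 * eta)) => //.
  move=> y; rewrite indicE; case: (boolP (y \in _)) => [|_].
    rewrite inE/= in_itv/= => /andP[y0 y1]; rewrite mulr1; apply: tent_mid => //.
      by rewrite opprK; lra.
    by rewrite opprK; lra.
  by rewrite mulr0 tent_ge0.
rewrite ler_pdivlMr//.
have e0 := eta0; have m0' := m0.
move: h1 h2; set p := pr _; set a := Etent _; set c := Estep _ => h1 h2 h3.
have : m * (3 * eta * p) <= 6 * eta ^+ 2 by apply: le_trans h1; apply: le_trans h3; rewrite ler_pM2l.
rewrite (_ : m * (3 * eta * p) = 3 * eta * (p * m)); last by ring.
rewrite (_ : 6 * eta ^+ 2 = 3 * eta * (2 * eta)); last by ring.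
by rewrite ler_pM2l// mulr_gt0.
Qed.

Lemma Estep_lower x : 6 * eta ^+ 2 * pr `[x + 2 * eta, +oo[%classic <= Estep x.
Proof.
apply: (@ge_indic (fun y => step (y - x)) _ (6 * eta ^+ 2)) => //.
move=> y; rewrite indicE; case: (boolP (y \in _)) => [|_].
  rewrite inE/= in_itv/= andbT => xy; rewrite mulr1 step_right//.
  by rewrite lerBrDl.
by rewrite mulr0 step_ge0.
Qed.

End fixed_step.

(** [Estep] lies between [6 * eta ^+ 2] times the masses beyond x + 2 eta and
    beyond x.  Its value at 0 is nearly 6 eta^2, because by [pr_ball_small]
    little mass is close to 0. *)
Lemma tail_ge x : 0 <= x -> expR (- (x / m)) <= pr `]x, +oo[%classic.
Proof.
move=> x0; have m0' := m0.
apply: (@ler_addgt0_mul R _ _ (8 / m)) => e e0 e1.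
have e2 : 0 < 6 * e ^+ 2 by rewrite mulr_gt0// exprn_gt0.
have h1 := Estep_upper e0 x.
have h2 := Estep_lower e0 0; rewrite add0r in h2.
have h3 := Estep_exp e0 x0.
have h4 := @pr_ball_small (4 * e) ltac:(lra).
have h5 : 1 <= pr `[0, 4 * e / 2]%classic + pr `[2 * e, +oo[%classic.
  rewrite -lee_fin EFinD !pr_fineK//.
  rewrite -(@probability_setT _ _ _ nu) -[leRHS]add0e -nu_neg.
  apply: (@le_trans _ _ (nu (`]-oo, 0[ `|` (`[0, 4 * e / 2] `|` `[2 * e, +oo[))%classic)).
    apply: le_measure; rewrite ?inE//; first by do 2 ?apply: measurableU.
    move=> y _ /=; rewrite !in_itv/= andbT.
    have [y0|y0] := ltP y 0; first by left.
    right; have [y1|y1] := leP y (4 * e / 2); [by left|right; lra].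
  apply: le_trans (measureU2 _ _ _) _ => //; first exact: measurableU.
  by rewrite leeD2l// measureU2.
have E0 := expR_gt0 (- (x / m)).
have E1 : expR (- (x / m)) <= 1 by rewrite -[leRHS]expR0 ler_expR oppr_le0 divr_ge0// ltW.
have m1 : 0 < m^-1 by rewrite invr_gt0.
rewrite -(ler_pM2l e2); apply: (@le_trans _ _ (Estep e x + 6 * e ^+ 2 * (e * (8 / m)))); last first.
  by rewrite mulrDr lerD2r.
rewrite h3.
apply: (@le_trans _ _ (6 * e ^+ 2 * pr `[2 * e, +oo[%classic * expR (- (x / m)) + 6 * e ^+ 2 * (e * (8 / m)))); last first.
  by rewrite lerD2r ler_pM2r.
rewrite -mulrA -mulrDr ler_pM2l//.
have : 0 <= e * (8 / m) by rewrite mulr_ge0 ?divr_ge0// ltW.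
have -> : e * (8 / m) = 2 * (4 * e) / m by field; rewrite gt_eqF.
move: h4 h5; set p := pr _; set q := pr _; set t := _ / m => h4 h5 t0.
nra.
Qed.

(** The same sandwich, read at x - 2 eta. *)
Lemma tail_le x : 0 < x -> pr `[x, +oo[%classic <= expR (- (x / m)).
Proof.
move=> x0; have m0' := m0.
apply: (@ler_addgt0_mul R _ _ 1) => e e0 e1; rewrite mulr1.
pose eta := e * Num.min (m / 4) (x / 4).
have mm : 0 < Num.min (m / 4) (x / 4) by rewrite lt_min !divr_gt0.
have eta0 : 0 < eta by rewrite mulr_gt0.
have eta_m : eta <= e * (m / 4) by rewrite ler_pM2l// ge_min lexx.
have eta_x : 2 * eta <= x.
  have : eta <= e * (x / 4) by rewrite ler_pM2l// ge_min lexx orbT.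
  nra.
have xe0 : 0 <= x - 2 * eta by rewrite subr_ge0.
have e2 : 0 < 6 * eta ^+ 2 by rewrite mulr_gt0// exprn_gt0.
have h1 := Estep_lower eta0 (x - 2 * eta); rewrite subrK in h1.
have h2 := Estep_upper eta0 0.
have h3 := Estep_exp eta0 xe0.
have E0 := expR_gt0 (- ((x - 2 * eta) / m)).
have h4 : pr `[x, +oo[%classic <= expR (- ((x - 2 * eta) / m)).
  rewrite -(ler_pM2l e2) (le_trans h1)// h3 ler_pM2r// (le_trans h2)//.
  by rewrite ler_piMr ?pr_le1// ltW.
apply: (le_trans h4).
have -> : - ((x - 2 * eta) / m) = - (x / m) + 2 * eta / m by ring.
rewrite expRD.
have t1 : 2 * eta / m <= e / 2.
  by rewrite ler_pdivrMr//; lra.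
have h5 : expR (2 * eta / m) <= 1 + 2 * (2 * eta / m).
  by apply: expR_le1D2x; [rewrite divr_ge0 ?mulr_ge0// ltW|lra].
have E2 := expR_gt0 (- (x / m)).
have E1 : expR (- (x / m)) <= 1 by rewrite -[leRHS]expR0 ler_expR oppr_le0 divr_ge0// ltW.
move: E2 E1 h5 t1; set a := expR (- (x / m)); set t := 2 * eta / m; set c := expR t.
move=> a0 a1 ct te; nra.
Qed.

Lemma exponential_tail x : 0 <= x ->
  nu `]x, +oo[%classic = (expR (- (x / m)))%:E /\
  nu `[x, +oo[%classic = (expR (- (x / m)))%:E.
Proof.
move=> x0.
have sub : `]x, +oo[%classic `<=` `[x, +oo[%classic.
  by apply: subset_itvr; rewrite bnd_simp.
have up : pr `[x, +oo[%classic <= expR (- (x / m)).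
  move: x0; rewrite le_eqVlt => /predU1P[<-|]; last exact: tail_le.
  by rewrite mul0r oppr0 expR0 pr_le1.
have lo := tail_ge x0.
have mid : pr `]x, +oo[%classic <= pr `[x, +oo[%classic by exact: pr_le.
rewrite -!pr_fineK//; split; congr EFin; apply/eqP; rewrite eq_le.
  by rewrite lo (le_trans mid up).
by rewrite up (le_trans lo mid).
Qed.

End exponential_tail.

(** * Stationary law of the queue *)

Lemma nneseries_cvg_series (R : realType) (u : nat -> R) (l : R) :
  (forall i, 0 <= u i) -> (\sum_(0 <= i <oo) (u i)%:E = l%:E)%E ->
  (\sum_(0 <= i < n) u i) @[n --> \oo] --> l.
Proof.
move=> u0 ul.
have := @is_cvg_nneseries R (EFin \o u) xpredT 0 (fun n _ _ => u0 n).
move=> /cvg_ex[/= l' cl'].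
have l'E : l' = l%:E by rewrite -ul; apply/esym/cvg_lim.
move: cl'; rewrite l'E => /fine_cvgP[_].
by apply: cvg_trans; apply: near_eq_cvg; apply: nearW => n /=; rewrite sumEFin.
Qed.

Lemma partial_sum_le (R : realType) (u : nat -> R) (l : R) n :
  (forall i, 0 <= u i) -> (\sum_(0 <= i <oo) (u i)%:E = l%:E)%E ->
  \sum_(0 <= i < n) u i <= l.
Proof.
move=> u0 ul; rewrite -lee_fin -ul -sumEFin.
by apply: nneseries_lim_ge => i _ _; rewrite lee_fin.
Qed.

Lemma limn_series_finite (R : realType) (F : nat -> R) n :
  (forall j, (n <= j)%N -> F j = 0) -> limn (series F) = \sum_(0 <= j < n) F j.
Proof.
move=> F0; apply: cvg_lim => //; apply: cvg_near_cst.
exists n => // N /= nN; rewrite /series/= (big_cat_nat (n := n))//=.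
rewrite [X in _ + X]big_nat_cond [X in _ + X]big1 ?addr0// => j /andP[/andP[nj _] _].
exact: F0.
Qed.

Section mm1.
Context {R : realType}.
Variables (delta lambda mu : R).
Hypotheses (delta0 : 0 < delta) (lambda0 : 0 < lambda) (mu0 : 0 < mu).
Variable p : R -> nat -> nat -> R.
Hypothesis semi : markov_semigroup p.
Hypothesis gen : has_mm1_generator delta lambda mu p.

Let q := lambda + mu.

Let row_le1 t i n : 0 <= t -> \sum_(0 <= j < n) p t i j <= 1.
Proof.
move=> t0; apply: partial_sum_le; last exact: semigroup_sum1.
by move=> j; exact: semigroup_ge0.
Qed.

Let p_le1 t i : 0 <= t -> p t i i <= 1.
Proof.
move=> t0; apply: le_trans (row_le1 i i.+1 t0); rewrite big_nat_recr//= lerDr.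
by apply: sumr_ge0 => j _; exact: semigroup_ge0.
Qed.

Let p_super s t i : 0 <= s -> 0 <= t -> p s i i * p t i i <= p (s + t) i i.
Proof.
move=> s0 t0.
have := @partial_sum_le _ (fun k => p s i k * p t k i) (p (s + t) i i) i.+1.
move=> /(_ (fun k => mulr_ge0 (semigroup_ge0 semi _ _ s0) (semigroup_ge0 semi _ _ t0))).
move=> /(_ (esym (semigroupD semi i i s0 t0))); apply: le_trans.
rewrite big_nat_recr//= lerDr; apply: sumr_ge0 => j _.
by rewrite mulr_ge0//; exact: semigroup_ge0.
Qed.

Let p_iter t i n : 0 <= t -> p t i i ^+ n <= p (n%:R * t) i i.
Proof.
move=> t0; elim: n => [|n ih]; first by rewrite expr0 mul0r (semigroup0 semi) eqxx.
rewrite exprS -natr1 mulrDl mul1r addrC; apply: le_trans (p_super i t0 _); last by rewrite mulr_ge0.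
by rewrite ler_wpM2l//; exact: semigroup_ge0.
Qed.

Let gen_at (f : R -> R) (M : R) i : (forall k : nat, `|f (delta * k%:R)| <= M) ->
  forall e : R, 0 < e -> exists2 r, 0 < r & forall t, 0 < t -> t < r ->
  `|mm1_generator delta lambda mu f i - t^-1 *
    (limn (series (fun j => p t i j * f (delta * j%:R))) - f (delta * i%:R))| < e.
Proof.
move=> fM e e0; have /cvgrPdist_lt /(_ e e0) := @gen f (ex_intro _ M fM) i.
rewrite /at_right near_withinE => /nbhs_ballP[r /= r0 Hr].
exists r => // t t0 tr; apply: Hr => //.
by rewrite /ball/= sub0r normrN gtr0_norm.
Qed.

(** The generator gives the bound for the small time t / n up to an arbitrarily
    small error, and Bernoulli's inequality transports it to t. *)
Lemma holding_bound t i : 0 <= t -> 1 - p t i i <= q * t.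
Proof.
rewrite le_eqVlt => /predU1P[<-|t0].
  by rewrite (semigroup0 semi) eqxx mulr0 subrr.
rewrite -ler_pdivrMr//; apply/ler_addgt0Pr => e e0.
pose f (x : R) : R := (x == delta * i%:R)%:R.
have fE j : f (delta * j%:R) = (j == i)%:R.
  by rewrite /f (inj_eq (mulfI (lt0r_neq0 delta0))) eqr_nat.
have fM (k : nat) : `|f (delta * k%:R)| <= 1.
  by rewrite fE; case: (k == i); rewrite ?normr1 ?normr0.
have [r r0 Hr] := gen_at i fM e0.
have [n ntr] : exists n : nat, t / n.+1%:R < r.
  exists (Num.truncn (t / r)); rewrite ltr_pdivrMr// mulrC -ltr_pdivrMr//.
  exact: truncnS_gt.
pose s := t / n.+1%:R.
have s0 : 0 < s by rewrite divr_gt0.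
have := Hr s s0 ntr.
rewrite (@limn_series_finite _ _ i.+1); last first.
  by move=> j ij; rewrite fE gtn_eqF ?mulr0.
rewrite big_nat_recr//= big_nat_cond big1; last first.
  by move=> j /andP[/andP[_ ji] _]; rewrite fE ltn_eqF ?mulr0.
rewrite add0r !fE eqxx (_ : true%:R = 1 :> R)// mulr1 /mm1_generator !fE => Hs.
have Gq : - q <= lambda * ((i.+1 == i)%:R - (i == i)%:R) +
   (if (0 < i)%N then mu * ((i.-1 == i)%:R - (i == i)%:R) else 0).
  have m0 := mu0; have l0 := lambda0.
  rewrite eqxx gtn_eqF// sub0r /q; case: ifP => [i0|_]; last by rewrite ?mulr1n ?mulrN1 ?mulr1 addr0; lra.
  by rewrite ltn_eqF ?prednK// !sub0r mulr1n !mulrN1 opprD.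
have sq : (1 - p s i i) / s <= q + e.
  move: Hs Gq; set G := (X in `|X - _|); rewrite ltr_norml => /andP[h1 h2] h3.
  rewrite (_ : (1 - p s i i) / s = - (s^-1 * (p s i i - 1))); last by ring.
  by rewrite -/G in h3; lra.
have ts : t = n.+1%:R * s by rewrite /s mulrC divfK// gt_eqF.
have h := le_trans (bernoulli_le n.+1 (semigroup_ge0 semi i i (ltW s0)) (p_le1 i (ltW s0)))
  (p_iter i n.+1 (ltW s0)).
rewrite -ts in h.
apply: le_trans sq; rewrite ler_pdivrMr// ts.
have -> : (1 - p s i i) / s * (n.+1%:R * s) = n.+1%:R * (1 - p s i i).
  by field; rewrite gt_eqF.
rewrite -ts; lra.
Qed.

Variable pi_ : nat -> R.
Hypotheses (pi0 : forall i, 0 <= pi_ i)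
  (pi1 : (\sum_(0 <= i <oo) (pi_ i)%:E = 1)%E)
  (pi_stat : forall t j, 0 <= t ->
     (\sum_(0 <= i <oo) (pi_ i * p t i j)%:E = (pi_ j)%:E)%E).

Let D (k : nat) t i := \sum_(0 <= j < k.+1) p t i j - (i <= k)%N%:R.

(** Starting from i, the indicator of {0, ..., k} changes only if the chain has
    left i. *)
Let D_bound k t i : 0 <= t -> `|D k t i| <= q * t.
Proof.
move=> t0; apply: le_trans (holding_bound i t0).
have pos j : 0 <= p t i j by exact: semigroup_ge0.
rewrite /D; have [ik|ki] := leqP i k.
  rewrite ler0_norm ?subr_le0 ?row_le1// opprB lerD2l lerN2.
  rewrite (big_cat_nat (n := i.+1))//= big_nat_recr//= -addrA addrCA lerDl.
  by rewrite addr_ge0// sumr_ge0.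
rewrite subr0 ger0_norm ?sumr_ge0// lerBrDr.
apply: le_trans (row_le1 i i.+1 t0).
rewrite [leRHS]big_nat_recr//= lerD2r [leRHS](big_cat_nat (n := k.+1))//= lerDl.
by rewrite sumr_ge0.
Qed.

Let tau N := 1 - \sum_(0 <= i < N) pi_ i.

(** The full sum over i vanishes by stationarity, so a partial sum equals minus
    its tail, which [D_bound] controls by the mass of the tail. *)
Let sum_D_bound k t N : 0 <= t ->
  `|\sum_(0 <= i < N) pi_ i * D k t i| <= q * t * tau N.
Proof.
move=> t0.
have cvD : (\sum_(0 <= i < n) pi_ i * D k t i) @[n --> \oo] --> (0 : R).
  have c1 : (\sum_(0 <= i < n) pi_ i * \sum_(0 <= j < k.+1) p t i j) @[n --> \oo]
      --> \sum_(0 <= j < k.+1) pi_ j.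
    rewrite (_ : (fun n => _) = (fun n => \sum_(0 <= j < k.+1) \sum_(0 <= i < n) pi_ i * p t i j)); last first.
      apply/funext => n; rewrite exchange_big/=; apply: eq_bigr => i _.
      by rewrite mulr_sumr.
    apply: cvg_big => //=; first exact: add_continuous.
    move=> j _; apply: nneseries_cvg_series; last exact: pi_stat.
    by move=> i; rewrite mulr_ge0//; exact: semigroup_ge0.
  have c2 : (\sum_(0 <= i < n) pi_ i * (i <= k)%N%:R) @[n --> \oo]
      --> \sum_(0 <= j < k.+1) pi_ j.
    apply: cvg_near_cst; exists k.+1 => // n /= kn.
    rewrite (big_cat_nat (n := k.+1))//= [X in _ + X]big_nat_cond [X in _ + X]big1 ?addr0.
      by apply: eq_big_nat => i /andP[_ ik]; rewrite -ltnS ik mulr1.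
    by move=> i /andP[/andP[ki _] _]; rewrite leqNgt ki mulr0.
  have c3 : (\sum_(0 <= i < n) pi_ i * \sum_(0 <= j < k.+1) p t i j -
      \sum_(0 <= i < n) pi_ i * (i <= k)%N%:R) @[n --> \oo] --> (0 : R).
    by rewrite -[X in _ --> X](subrr (\sum_(0 <= j < k.+1) pi_ j)); exact: cvgB.
  rewrite (_ : (fun n => _) = (fun n => \sum_(0 <= i < n) pi_ i * \sum_(0 <= j < k.+1) p t i j -
      \sum_(0 <= i < n) pi_ i * (i <= k)%N%:R))//.
  apply/funext => n; rewrite -sumrB; apply: eq_bigr => i _.
  by rewrite /D mulrBr.
have cvT : (\sum_(0 <= i < n) pi_ i) @[n --> \oo] --> (1 : R).
  exact: nneseries_cvg_series.
have : (q * t * (\sum_(0 <= i < n) pi_ i - \sum_(0 <= i < N) pi_ i) +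
    `|\sum_(0 <= i < n) pi_ i * D k t i|) @[n --> \oo] --> q * t * tau N + `|0 : R|.
  apply: cvgD; last exact: cvg_norm.
  by apply: cvgM; [exact: cvg_cst|apply: cvgB => //; exact: cvg_cst].
rewrite normr0 addr0 => cv.
apply: (cvgr_to_ge cv); exists N => // n /= Nn.
rewrite [\sum_(0 <= i < n) pi_ i](big_cat_nat (n := N))//.
rewrite [\sum_(0 <= i < n) (_ * _)](big_cat_nat (n := N))//=.
set a := \sum_(0 <= i < N) _ * _; set c := \sum_(N <= i < n) _ * _.
have cb : `|c| <= q * t * \sum_(N <= i < n) pi_ i.
  rewrite mulr_sumr; apply: le_trans (ler_norm_sum _ _ _) _.
  apply: ler_sum => i _; rewrite normrM (ger0_norm (pi0 i)) mulrC.
  by rewrite ler_wpM2r// D_bound.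
rewrite [X in X - _]addrC addrK.
have := ler_normB (a + c) c; rewrite addrK; lra.
Qed.

(** In the partial sums of the generator applied to the indicator of
    {0, ..., k}, only the states k and k + 1 contribute. *)
Lemma mm1_balance k : mu * pi_ k.+1 = lambda * pi_ k.
Proof.
pose f (x : R) : R := (x <= delta * k%:R)%R%:R.
have fE j : f (delta * j%:R) = (j <= k)%N%:R.
  by rewrite /f ler_pM2l// ler_nat.
have fM (j : nat) : `|f (delta * j%:R)| <= 1.
  by rewrite fE; case: (j <= k)%N; rewrite ?normr1 ?normr0.
have Gf t i : 0 < t -> limn (series (fun j => p t i j * f (delta * j%:R))) - f (delta * i%:R) = D k t i.
  move=> t0; rewrite (@limn_series_finite _ _ k.+1); last first.
    by move=> j kj; rewrite fE leqNgt kj mulr0.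
  rewrite fE /D; congr (_ - _); apply: eq_big_nat => j /andP[_ jk].
  by rewrite fE -ltnS jk mulr1.
pose g i := mm1_generator delta lambda mu f i.
have gE N : (k.+2 <= N)%N -> \sum_(0 <= i < N) pi_ i * g i = mu * pi_ k.+1 - lambda * pi_ k.
  move=> kN; rewrite (big_cat_nat (n := k.+2))//= [X in _ + X]big_nat_cond [X in _ + X]big1 ?addr0; last first.
    move=> i /andP[/andP[ki _] _]; rewrite /g /mm1_generator !fE.
    have -> : (i.+1 <= k)%N = false by apply/negbTE; rewrite -ltnNge; lia.
    have -> : (i <= k)%N = false by apply/negbTE; rewrite -ltnNge; lia.
    have -> : (i.-1 <= k)%N = false by apply/negbTE; rewrite -ltnNge; lia.
    by rewrite subrr mulr0 mulr0 if_same addr0 mulr0.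
  rewrite !big_nat_recr//= big_nat_cond big1 ?add0r; last first.
    move=> i /andP[/andP[_ ik] _]; rewrite /g /mm1_generator !fE.
    rewrite ik (ltnW ik) (leq_trans (leq_pred i) (ltnW ik)).
    by rewrite subrr mulr0 mulr0 if_same addr0 mulr0.
  rewrite /g /mm1_generator !fE /= ltnn leqnn leq_pred.
  have -> : (k.+2 <= k)%N = false by apply/negbTE; rewrite -ltnNge; lia.
  rewrite (_ : true%:R = 1 :> R)// (_ : false%:R = 0 :> R)//.
  by case: ifP => _; ring.
have q0 : 0 <= q by rewrite addr_ge0// ltW.
have key N : `|\sum_(0 <= i < N) pi_ i * g i| <= q * tau N.
  have c1 : t^-1 * (\sum_(0 <= i < N) pi_ i * D k t i) @[t --> 0^'+] --> \sum_(0 <= i < N) pi_ i * g i.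
    have : \sum_(0 <= i < N) (pi_ i * (t^-1 * (limn (series (fun j => p t i j * f (delta * j%:R))) - f (delta * i%:R)))) @[t --> 0^'+] --> \sum_(0 <= i < N) pi_ i * g i.
      apply: cvg_big => //=; first exact: add_continuous.
      move=> i _; apply: cvgM; first exact: cvg_cst.
      by apply: (@gen f _ i); exists 1.
    apply: cvg_trans; apply: near_eq_cvg; near=> t.
    have t0 : 0 < t by near: t; exact: nbhs_right_gt.
    rewrite mulr_sumr; apply: eq_bigr => i _; rewrite Gf//; ring.
  apply: (cvgr_to_le (cvg_norm c1)); near=> t.
  have t0 : 0 < t by near: t; exact: nbhs_right_gt.
  rewrite normrM gtr0_norm ?invr_gt0// ler_pdivrMl//.
  by apply: (le_trans (sum_D_bound k N (ltW t0))); rewrite -mulrA mulrCA.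
apply/eqP; rewrite -subr_eq0 -normr_le0.
have ct : (q * tau N) @[N --> \oo] --> q * (1 - 1).
  apply: cvgM; first exact: cvg_cst.
  by apply: cvgB; [exact: cvg_cst|exact: nneseries_cvg_series].
rewrite subrr mulr0 in ct.
apply: (cvgr_to_ge ct); exists k.+2 => // N /= kN.
by rewrite -(gE N kN).
Unshelve. all: by end_near.
Qed.

Hypothesis rho1 : lambda / mu < 1.

Lemma mm1_geometric k : pi_ k = (1 - lambda / mu) * (lambda / mu) ^+ k.
Proof.
set r := lambda / mu.
have r0 : 0 < r by rewrite divr_gt0.
have piE j : pi_ j = pi_ 0%N * r ^+ j.
  elim: j => [|j ih]; first by rewrite expr0 mulr1.
  apply: (mulfI (x := mu)); first by rewrite gt_eqF.
  by rewrite mm1_balance ih exprS /r; field; rewrite gt_eqF.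
suff p0 : pi_ 0%N = 1 - r by rewrite piE p0.
have c1 : (\sum_(0 <= i < n) pi_ i) @[n --> \oo] --> (1 : R) by exact: nneseries_cvg_series.
have c2 : (\sum_(0 <= i < n) pi_ i) @[n --> \oo] --> pi_ 0%N / (1 - r).
  have := @cvg_geometric_series R (pi_ 0%N) r; rewrite gtr0_norm// => /(_ rho1).
  apply: cvg_trans; apply: near_eq_cvg; apply: nearW => n.
  by rewrite /series/=; apply: eq_bigr => i _; rewrite [RHS]piE.
have := cvg_unique _ c1 c2 => /(_ (@norm_hausdorff _ _)) E.
by rewrite -[RHS]mul1r [X in X * _]E divfK// subr_eq0 gt_eqF.
Qed.

End mm1.

Lemma mm1_stationary_geometric (R : realType) (delta lambda mu : R) (nu : probability R R) :
  0 < delta -> 0 < lambda -> 0 < mu -> lambda / mu < 1 ->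
  mm1_stationary delta lambda mu nu ->
  forall k : nat, nu [set delta * k%:R] = ((1 - lambda / mu) * (lambda / mu) ^+ k)%:E.
Proof.
move=> d0 l0 m0 r1 [nu1 [p [semi gen stat]]] k.
have m1 (x : R) : measurable [set x] by exact: measurable_set1.
have piE j : nu [set delta * j%:R] = (fine (nu [set delta * j%:R]))%:E.
  by rewrite fineK// fin_num_measure.
rewrite piE; congr EFin.
apply: (@mm1_geometric R delta lambda mu d0 l0 m0 p semi gen (fun j => fine (nu [set delta * j%:R]))) => //.
- by move=> i; exact: fine_ge0.
- transitivity (nu (range (fun j : nat => delta * j%:R))) => //.
  have -> : range (fun j : nat => delta * j%:R) = \bigcup_j [set delta * j%:R].
    apply/seteqP; split => x /=; first by move=> [j _ <-]; exists j.
    by move=> [j _ ->]; exists j.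
  rewrite measure_bigcup//=; last first.
    apply/trivIsetP => i j _ _ ij; apply/seteqP; split => x //= [-> /(mulfI _)].
    by rewrite gt_eqF// => /(_ isT) /eqP; rewrite eqr_nat (negbTE ij).
  rewrite [RHS](@eq_eseriesl _ _ xpredT); last by move=> j; rewrite in_setT.
  by apply: eq_eseriesr => j _; rewrite -piE.
- move=> t j t0; rewrite -piE -(stat t j t0); apply: eq_eseriesr => i _.
  by rewrite EFinM -piE.
Qed.

(** * Stationary law of the reflected Brownian motion *)

Section rbm_stationary_law.
Context {R : realType} d (T : measurableType d) (P : probability T R).
Variables (delta lambda mu : R) (W Y L : R -> {RV P >-> R}).
Hypotheses (delta0 : 0 < delta) (lambda0 : 0 < lambda) (lambda_mu : lambda < mu).
Hypothesis rbm : reflected_brownian_motion delta lambda mu W Y L.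
Variable nu : probability R R.
Hypothesis stat : forall (t : R) (A : set R), 0 <= t -> measurable A ->
  distribution P (Y t) A = nu A.

Let m := delta * (lambda + mu) / (2 * (mu - lambda)).
Let mu0 : 0 < mu. Proof. exact: lt_trans lambda_mu. Qed.
Let a := delta * (mu - lambda).
Let a0 : 0 < a. Proof. by rewrite mulr_gt0// subr_gt0. Qed.

Let generatorE (f1 f2 : R -> R) :
  nu.-integrable setT (EFin \o (fun y => m * f2 y - f1 y)) ->
  \int[nu]_y (delta * (lambda - mu) * f1 y +
    (delta * Num.sqrt (lambda + mu)) ^+ 2 / 2 * f2 y) =
  a * \int[nu]_y (m * f2 y - f1 y).
Proof.
move=> i; rewrite -RintegralZl//; apply: eq_Rintegral => y _.
rewrite exprMn sqr_sqrtr ?addr_ge0 ?ltW// /a /m.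
by field; rewrite subr_eq0 gt_eqF.
Qed.

Let itest f f1 f2 : smooth_test f f1 f2 ->
  nu.-integrable setT (EFin \o (fun y => m * f2 y - f1 y)).
Proof.
move=> [_ mf1 mf2 [M [K [_ f1M f2M _]]]].
have i1 : nu.-integrable setT (EFin \o f1) by exact: (@bounded_integrable _ _ _ nu f1 M).
have i2 : nu.-integrable setT (EFin \o f2) by exact: (@bounded_integrable _ _ _ nu f2 M).
by have := integrableB measurableT (integrable_EFinZ m i2) i1; exact.
Qed.

(** The generator is [a] times [m f'' - f'], with [a] minus the drift. *)
Lemma rbm_stationary_tail x : 0 <= x ->
  nu `]x, +oo[%classic = (expR (- (x / m)))%:E /\
  nu `[x, +oo[%classic = (expR (- (x / m)))%:E.
Proof.
apply: exponential_tail.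
- by rewrite /m divr_gt0// mulr_gt0// ?subr_gt0// addr_gt0.
- rewrite -(stat (lexx 0))//= /distribution /pushforward.
  rewrite (_ : _ @^-1` _ = set0) ?measure0//.
  by apply/seteqP; split => w //=; rewrite in_itv/= ltNge (rbm_ge0 rbm).
- move=> f f1 f2 H fnd; have i := itest H.
  rewrite -(pmulr_rle0 _ a0) -(generatorE i).
  have [mf mf1 mf2 [M [K [fM f1M f2M taylor]]]] := H.
  exact: (stationary_generator_le0 rbm stat mf mf1 mf2 fM f1M f2M taylor).
- move=> f f1 f2 e H e0 fe; have i := itest H.
  have [mf mf1 mf2 [M [K [fM f1M f2M taylor]]]] := H.
  apply: (mulfI (lt0r_neq0 a0)); rewrite mulr0 -(generatorE i).
  have e3 : 0 < e / 3 by rewrite divr_gt0.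
  apply: (stationary_generator_eq0 delta0 lambda0 mu0 rbm stat mf mf1 mf2 fM f1M f2M taylor e3).
  by move=> y ye; apply: fe; lra.
Qed.

End rbm_stationary_law.

(** * Comparison of the two laws *)

Section same_law.
Context {R : realType} d1 (T1 : measurableType d1) (P1 : probability T1 R)
  d2 (T2 : measurableType d2) (P2 : probability T2 R).

Lemma same_law_integral (X1 : {RV P1 >-> R}) (X2 : {RV P2 >-> R}) (h : R -> R) :
  measurable_fun setT h ->
  (forall A, measurable A -> distribution P1 X1 A = distribution P2 X2 A) ->
  P2.-integrable setT (EFin \o (h \o X2)) ->
  ('E_P1[h \o X1] = 'E_P2[h \o X2])%E.
Proof.
move=> mh E i2.
have mhE : measurable_fun setT (EFin \o h) by exact/measurable_EFinP.
have eqf (f : R -> \bar R) : (\int[distribution P1 X1]_x f x = \int[distribution P2 X2]_x f x)%E.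
  by apply: eq_measure_integral => A mA _; exact: E.
have i1 : P1.-integrable setT ((EFin \o h) \o X1).
  apply/integrableP; split; first exact: measurableT_comp.
  have mabs : measurable_fun setT (fun y => `|(h y)%:E|)%E by exact: measurableT_comp.
  have E1 := @ge0_integral_distribution _ _ _ _ _ P1 X1 _ mabs (fun y => abse_ge0 _).
  have E2 := @ge0_integral_distribution _ _ _ _ _ P2 X2 _ mabs (fun y => abse_ge0 _).
  rewrite eqf E2 in E1; rewrite -[X in (X < _)%E]E1.
  by move/integrableP : i2 => [].
rewrite unlock.
have := @integral_distribution _ _ _ _ _ P1 X1 (EFin \o h) mhE i1.
have := @integral_distribution _ _ _ _ _ P2 X2 (EFin \o h) mhE i2.
by rewrite /= => <- <-; exact: eqf.
Qed.

End same_law.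

Lemma lattice_law_unique {R : realType} (Q1 Q2 : probability R R) (delta : R) :
  0 < delta ->
  Q1 (range (fun k : nat => delta * k%:R)) = 1%E ->
  Q2 (range (fun k : nat => delta * k%:R)) = 1%E ->
  (forall k : nat, Q1 [set delta * k%:R] = Q2 [set delta * k%:R]) ->
  forall A, measurable A -> Q1 A = Q2 A.
Proof.
move=> d0; set D := range _ => q1 q2 q12 A mA.
have m1 (x : R) : measurable [set x] by exact: measurable_set1.
have DE : D = \bigcup_j [set delta * j%:R].
  apply/seteqP; split => x /=; first by move=> [j _ <-]; exists j.
  by move=> [j _ ->]; exists j.
have mD : measurable D by rewrite DE; exact: bigcupT_measurable.
have atoms (Q : probability R R) : Q D = 1%E ->
    (Q A = \sum_(j <oo) Q (A `&` [set (delta * j%:R)%R]))%E.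
  move=> QD.
  have QDC : Q (~` D) = 0%E by rewrite probability_setC// QD subee.
  have -> : Q A = Q (A `&` D).
    rewrite -[in LHS](setIT A) -(setUv D) setIUr measureU//; last 3 first.
    - exact: measurableI.
    - by apply: measurableI => //; exact: measurableC.
    - by rewrite setIACA setICr setI0.
    rewrite [X in (_ + X)%E](_ : _ = 0%E) ?adde0//.
    apply/eqP; rewrite eq_le measure_ge0 andbT -QDC.
    by apply: le_measure; rewrite ?inE//; [apply: measurableI => //|]; exact: measurableC.
  rewrite DE setI_bigcupr measure_bigcup//=; last 2 first.
  - by move=> j _; exact: measurableI.
  - apply/trivIsetP => i j _ _ ij; apply/seteqP; split => x //= [[_ ->] [_ /(mulfI _)]].
    by rewrite gt_eqF// => /(_ isT) /eqP; rewrite eqr_nat (negbTE ij).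
  by rewrite [LHS](@eq_eseriesl _ _ xpredT)// => j; rewrite in_setT.
rewrite !atoms//; apply: eq_eseriesr => j _.
have [Aj|nAj] := pselect (A (delta * j%:R)).
  by rewrite (_ : _ `&` _ = [set delta * j%:R]) ?q12//; apply/setIidr => x ->.
rewrite (_ : _ `&` _ = set0) ?measure0//.
by apply/seteqP; split => x //= [Ax xE]; rewrite xE in Ax.
Qed.

Section rounding.
Context {R : realType} (c delta : R).
Hypotheses (c0 : 0 < c) (delta0 : 0 < delta).

Definition lattice_round (x : R) : R := delta * (Num.truncn (x / c))%:R.

Lemma measurable_lattice_round : measurable_fun setT lattice_round.
Proof.
apply: nondecreasing_measurable => // x y xy.
rewrite /lattice_round ler_pM2l// ler_nat le_truncn// ler_pM2r// invr_gt0//.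
Qed.

Lemma lattice_round_preimage (k : nat) x : 0 <= x ->
  lattice_round x = delta * k%:R <-> c * k%:R <= x < c * k.+1%:R.
Proof.
move=> x0; have xc : 0 <= x / c by rewrite divr_ge0// ltW.
rewrite [c * _]mulrC [c * _]mulrC -ler_pdivlMr// -ltr_pdivrMr//.
split => [/(mulfI (lt0r_neq0 delta0))/eqP|/andP[h1 h2]].
  by rewrite eqr_nat truncn_eq.
by congr (_ * _); apply/eqP; rewrite eqr_nat truncn_eq// h1.
Qed.

Lemma lattice_round_dist x : 0 <= x ->
  `|lattice_round x - x| <= delta + `|delta / c - 1| * x.
Proof.
move=> x0; have xc : 0 <= x / c by rewrite divr_ge0// ltW.
have /andP[t1 t2] := truncn_itv xc.
rewrite /lattice_round; set k := _%:R in t1 *.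
rewrite -natr1 -/k in t2.
have -> : delta * k - x = delta * (k - x / c) + (delta / c - 1) * x by field; rewrite gt_eqF.
rewrite (le_trans (ler_normD _ _))// !normrM (ger0_norm x0) lerD2r.
rewrite (gtr0_norm delta0) ler_piMr ?(ltW delta0)//.
by rewrite ler_norml; apply/andP; split; lra.
Qed.

End rounding.

(** The convexity bounds 1 - r <= - ln r <= (1 - r) / r place 1 / (- ln r) in an
    interval of length 1, of which (1 + r) / (2 (1 - r)) is the midpoint. *)
Lemma log_mean_bound {R : realType} (r : R) : 0 < r -> r < 1 ->
  `|(- ln r)^-1 - (1 + r) / (2 * (1 - r))| <= 2^-1.
Proof.
move=> r0 r1; set th := - ln r.
have er : expR (- th) = r by rewrite opprK lnK.
have e1 : expR th = r^-1 by rewrite -er expRN invrK.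
have h1 : 1 - r <= th by have := expR_ge1Dx (- th); rewrite er; lra.
have h2 : th <= (1 - r) / r.
  have := expR_ge1Dx th; rewrite e1 mulrBl mul1r divff ?gt_eqF//; lra.
have r10 : 0 < 1 - r by lra.
have th0 : 0 < th by lra.
have u1 : th^-1 <= (1 - r)^-1 by rewrite lef_pV2.
have u2 : r / (1 - r) <= th^-1.
  by rewrite -[r / _]invrK lef_pV2 ?posrE ?invr_gt0 ?divr_gt0// invf_div.
have -> : (1 + r) / (2 * (1 - r)) = (1 - r)^-1 - 2^-1 by field; rewrite gt_eqF.
have u3 : r / (1 - r) = (1 - r)^-1 - 1 by field; rewrite gt_eqF.
rewrite u3 in u2.
by rewrite ler_norml; apply/andP; split; lra.
Qed.

Lemma exponential_mean {R : realType} d (T : measurableType d) (P : probability T R)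
    (Y : {RV P >-> R}) (m : R) : 0 < m -> (forall w, 0 <= Y w) ->
  (forall x, 0 <= x -> distribution P Y `]x, +oo[%classic = (expR (- (x / m)))%:E) ->
  (\int[P]_w (Y w)%:E = m%:E)%E.
Proof.
move=> m0 Y0 tail.
rewrite -expectation_def ge0_expectation_ccdf//.
have m1 : 0 < m^-1 by rewrite invr_gt0.
transitivity (\int[lebesgue_measure]_x (m%:E * (exponential_pdf m^-1 x)%:E))%E.
  rewrite [LHS]integral_mkcond; apply: eq_integral => x _.
  rewrite patchE /exponential_pdf patchE; case: ifPn => [|_]; last by rewrite mule0.
  rewrite inE/= in_itv/= andbT => x0; rewrite /ccdf tail// -EFinM mulrA divff ?gt_eqF//.
  by rewrite mul1r mulNr mulrC.
rewrite integralZl ?integral_exponential_pdf ?mule1//.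
exact: integrable_exponential_pdf.
Qed.

(** The positivity proofs are arguments because the measurability instance needs
    them. *)
Definition lattice_rv {R : realType} d (T : measurableType d) (c delta : R)
  (d0 : 0 < delta) (c0 : 0 < c) (X : {mfun T >-> R}) (w : T) : R :=
  lattice_round c delta (X w).

Lemma measurable_lattice_rv {R : realType} d (T : measurableType d) (c delta : R)
  (d0 : 0 < delta) (c0 : 0 < c) (X : {mfun T >-> R}) :
  measurable_fun setT (lattice_rv d0 c0 X).
Proof.
by apply: (measurableT_comp (measurable_lattice_round c0 d0)); exact: measurable_funPT.
Qed.

HB.instance Definition _ {R : realType} d (T : measurableType d) (c delta : R)
  (d0 : 0 < delta) (c0 : 0 < c) (X : {mfun T >-> R}) :=
  isMeasurableFun.Build _ _ _ _ (lattice_rv d0 c0 X) (measurable_lattice_rv d0 c0 X).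

Lemma Lip1_measurable {R : realType} (h : R -> R) : Lip1 h -> measurable_fun setT h.
Proof.
move=> hL; apply: continuous_measurable_fun => x.
apply/cvgrPdist_lt => e e0; near=> y.
by apply: le_lt_trans (hL x y) _; near: y; exact: cvgr_dist_lt.
Unshelve. all: by end_near.
Qed.

(** The value delta k is taken when Y lies in [c k, c (k+1)), and the tail of Y
    at c k is r^k. *)
Lemma rounded_exponential_geometric {R : realType} d (T : measurableType d)
    (P : probability T R) (Y : {RV P >-> R}) (m delta r c : R)
    (d0 : 0 < delta) (c0 : 0 < c) :
  0 < m -> 0 < r -> c = m * - ln r -> (forall w, 0 <= Y w) ->
  (forall x, 0 <= x -> distribution P Y `[x, +oo[%classic = (expR (- (x / m)))%:E) ->
  forall k : nat, distribution P (lattice_rv d0 c0 Y) [set delta * k%:R] =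
    ((1 - r) * r ^+ k)%:E.
Proof.
move=> m0 r0 cE Y0 tail k.
have ck (j : nat) : 0 <= c * j%:R by rewrite mulr_ge0// ltW.
have tailE (j : nat) : distribution P Y `[c * j%:R, +oo[%classic = (r ^+ j)%:E.
  rewrite tail// cE; congr EFin.
  rewrite (_ : - (m * - ln r * j%:R / m) = j%:R * ln r); last by field; rewrite gt_eqF.
  by rewrite expRM_natl lnK.
have -> : distribution P (lattice_rv d0 c0 Y) [set delta * k%:R] =
    distribution P Y `[c * k%:R, c * k.+1%:R[%classic.
  rewrite /distribution /pushforward; congr (P _).
  apply/seteqP; split => w /=; rewrite in_itv/=;
    by move/(lattice_round_preimage c0 d0 k (Y0 w)).
have split_itv : `[c * k%:R, +oo[%classic =
    `[c * k%:R, c * k.+1%:R[%classic `|` `[c * k.+1%:R, +oo[%classic :> set R.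
  apply/seteqP; split => x /=; rewrite !in_itv/= !andbT.
    by move=> ->; have [xk|xk] := ltP x (c * k.+1%:R); [left|right].
  case=> [/andP[]//|]; apply: le_trans.
  by rewrite ler_pM2l// ler_nat.
have := tailE k; rewrite split_itv measureU//=; last first.
  apply/seteqP; split => x //=; rewrite !in_itv/= andbT => -[/andP[_ h1] h2].
  by move: h1; rewrite ltNge h2.
rewrite [X in (_ + X)%E](tailE k.+1) => E.
have -> : distribution P Y `[c * k%:R, c * k.+1%:R[%classic =
    ((r ^+ k)%:E - (r ^+ k.+1)%:E)%E.
  by rewrite -E addeK.
by rewrite -EFinB exprS mulrBl mul1r.
Qed.

Theorem theorem2 (R : realType) :
  exists C : R, 0 < C /\
  forall (delta lambda mu : R) (h : R -> R),
    0 < delta -> 0 < lambda -> 0 < mu ->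
    let rho := lambda / mu in
    rho < 1 -> Lip1 h ->
    forall (d1 : measure_display) (T1 : measurableType d1)
           (P1 : probability T1 R) (X : {RV P1 >-> R})
           (d2 : measure_display) (T2 : measurableType d2)
           (P2 : probability T2 R) (Y : {RV P2 >-> R}),
      mm1_stationary delta lambda mu (distribution P1 X) ->
      rbm_stationary delta lambda mu (distribution P2 Y) ->
      (`| 'E_P1[h \o X] - 'E_P2[h \o Y] |
         <= (C * delta * (1 + rho^-1))%:E)%E.
Proof.
(* The rounding error delta and the error delta / 2 on the mean add up to less
   than 2 delta. *)
exists 2; split => // delta lambda mu h d0 l0 mu0 rho rho1 hL d1 T1 P1 X d2 T2 P2 Y sX sY.
have rho0 : 0 < rho by rewrite divr_gt0.
have lm : lambda < mu by move: rho1; rewrite ltr_pdivrMr// mul1r.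
have Xgeo := mm1_stationary_geometric d0 l0 mu0 rho1 sX.
have [Xlat _] := sX.
have [d [T [P [W [Z [L [rbm stat]]]]]]] := sY.
pose m := delta * (lambda + mu) / (2 * (mu - lambda)).
have m0 : 0 < m by rewrite divr_gt0 ?mulr_gt0 ?subr_gt0// addr_gt0.
have Z0 w : 0 <= Z 0 w by exact: (rbm_ge0 rbm).
have Ztail x : 0 <= x -> distribution P (Z 0) `]x, +oo[%classic = (expR (- (x / m)))%:E /\
    distribution P (Z 0) `[x, +oo[%classic = (expR (- (x / m)))%:E.
  by move=> x0; rewrite !stat//; exact: (rbm_stationary_tail d0 l0 lm rbm stat).
have EZ : (\int[P]_w (Z 0 w)%:E = m%:E)%E.
  by apply: exponential_mean => // x /Ztail[].
have lnr0 : 0 < - ln rho by rewrite oppr_gt0 ln_lt0// rho0.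
pose c := m * - ln rho.
have c0 : 0 < c by rewrite mulr_gt0.
pose X' : {RV P >-> R} := lattice_rv d0 c0 (Z 0).
have X'geo := @rounded_exponential_geometric R d T P (Z 0) m delta rho c d0 c0
  m0 rho0 erefl Z0 (fun x x0 => (Ztail x x0).2).
have X'lat : distribution P X' (range (fun k : nat => delta * k%:R)) = 1%E.
  rewrite /distribution /pushforward (_ : _ @^-1` _ = setT) ?probability_setT//.
  by apply/seteqP; split => // w _ /=; exists (Num.truncn (Z 0 w / c)).
have mh := Lip1_measurable hL.
pose kappa := `|delta / c - 1|.
have close w : `|h (X' w) - h (Z 0 w)| <= delta + kappa * Z 0 w.
  by apply: le_trans (hL _ _) _; exact: lattice_round_dist.
have iZ : P.-integrable setT (EFin \o Z 0).
  apply/integrableP; split; first by apply/measurable_EFinP; exact: measurable_funPT.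
  by under eq_integral do rewrite gee0_abs ?lee_fin//; rewrite EZ ltry.
have mhZ : measurable_fun setT (h \o Z 0).
  by apply: measurableT_comp => //; exact: measurable_funPT.
have mhX : measurable_fun setT (h \o X').
  by apply: measurableT_comp => //; exact: measurable_funPT.
have ihZ : P.-integrable setT (EFin \o (h \o Z 0)).
  apply: (@dominated_integrable _ _ _ P _ (fun w => `|h 0| + Z 0 w)) => //.
    by apply: integrable_EFinD => //; exact: integrable_EFin_cst.
  move=> w /=; have := hL (Z 0 w) 0; rewrite subr0 (ger0_norm (Z0 w)) => hz.
  by rewrite -[h _](subrK (h 0)) (le_trans (ler_normD _ _))// addrC lerD2l.
have ig : P.-integrable setT (EFin \o (fun w => delta + kappa * Z 0 w)).
  by apply: integrable_EFinD; [exact: integrable_EFin_cst|exact: integrable_EFinZ].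
have idiff : P.-integrable setT (EFin \o (fun w => h (X' w) - h (Z 0 w))).
  by apply: (@dominated_integrable _ _ _ P _ _ _ ig) => //; exact: measurable_funB.
have ihX : P.-integrable setT (EFin \o (h \o X')).
  have := integrable_EFinD idiff ihZ; congr integrable.
  by apply/funext => w /=; rewrite subrK.
have -> : ('E_P1[h \o X] = 'E_P[h \o X'])%E.
  apply: same_law_integral => //; apply: (lattice_law_unique d0) => // k.
  by rewrite Xgeo; exact/esym/X'geo.
have -> : ('E_P2[h \o Y] = 'E_P[h \o Z 0%R])%E.
  by apply: same_law_integral => // A mA; rewrite stat.
have EE (f : T -> R) : P.-integrable setT (EFin \o f) -> ('E_P[f] = (\int[P]_w f w)%:E)%E.
  by move=> i; rewrite unlock /Rintegral fineK//; exact: integrable_fin_num.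
rewrite !EE// -EFinB abse_EFin lee_fin -RintegralB//.
apply: (le_trans (le_normr_Rintegral measurableT idiff)).
apply: (@le_trans _ _ (\int[P]_w (delta + kappa * Z 0 w))).
  by apply: le_Rintegral => //; exact: (integrable_norm idiff).
rewrite RintegralD//; [|exact: integrable_EFin_cst|exact: integrable_EFinZ].
rewrite Rintegral_probability_cst RintegralZl//.
have -> : \int[P]_w Z 0 w = m by rewrite /Rintegral EZ.
have mE : m = delta * ((1 + rho) / (2 * (1 - rho))).
  rewrite /m /rho; field.
  by rewrite !gt_eqF// subr_gt0 ?subr_gt0.
have -> : kappa * m = delta * `|(- ln rho)^-1 - (1 + rho) / (2 * (1 - rho))|.
  rewrite -[X in X * `| _ |](gtr0_norm d0) -normrM.
  rewrite (_ : kappa * m = `|(delta / c - 1) * m|); last by rewrite normrM (gtr0_norm m0).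
  congr `| _ |; rewrite mulrBr -mE /c mulrBl mul1r; congr (_ - _).
  have lnN0 : ln rho != 0 by rewrite -oppr_eq0 gt_eqF.
  by field; rewrite lnN0 gt_eqF.
have := log_mean_bound rho0 rho1; set b := `| _ | => hb.
have : delta * b <= delta * 2^-1 by rewrite ler_pM2l.
have : 0 <= delta * rho^-1 by rewrite mulr_ge0 ?invr_ge0// ltW.
rewrite mulrDr mulr1 -mulrA => ? ?; lra.
Qed.
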